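(* Let $\Gamma={\rm Heis}_3(\mathbb{Z})$ and let $h=x_1=p/q\in\mathbb{Q}\cap[0,1]$, $h\neq 0$, with $p,q$ relatively prime and $q\geq 1$. Then the restriction to $\Gamma$ of the Schr\''odinger representation $\rho_h$ of ${\rm Heis}_3(\mathbb{R})$ is unitarily equivalent to the direct integral $$\rho_h|_{\Gamma}\simeq \int_0^{1\,\oplus}\!\!\int_0^{1\,\oplus}\rho_{{\rm fin},(x_1,\{qx_1x_2\},x_3)}\,dm(x_2)\,dm(x_3),$$ where $\{a\}=a-[a]$ is the fractional part of $a\in\mathbb{R}$ and $dm$ is Lebesgue measure on $[0,1]$.
   Context: ${\rm Heis}_3(\mathbb{R})$ is the group of real matrices $(z,y,x):=\begin{pmatrix}1&x&z\\0&1&y\\0&0&1\end{pmatrix}$, and ${\rm Heis}_3(\mathbb{Z})$ is its subgroup of matrices with integer entries, whose elements are written $[n_1,n_2,n_3]:=\begin{pmatrix}1&n_3&n_1\\0&1&n_2\\0&0&1\end{pmatrix}$. For $h\in\mathbb{R}\setminus\{0\}$ the Schr\''odinger representation $\rho_h$ on $L^2(\mathbb{R})$ is $$(\rho_h((z,y,x))f)(s)=e^{2\pi\sqrt{-1}\,h(z+sy)}f(s+x).$$ For $x=(x_1,x_2,x_3)\in(\mathbb{Q}\cap[0,1])\times[0,1]\times[0,1]$ with $x_1=p/q$ in lowest terms, $\rho_{{\rm fin},x}$ is the $q$-dimensional unitary representation of $\Gamma$ on the space of complex sequences $\{\varphi(k)\}_{k\in\mathbb{Z}}$ of period $q$, given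 for $n=[n_1,n_2,n_3]$ by $$(\rho_{{\rm fin},x}(n)\varphi)(k)=\exp\Big(\frac{2\pi\sqrt{-1}}{q}\,(n_3x_3+n_2x_2+n_1qx_1+kn_2qx_1)\Big)\varphi(k+n_3).$$ *)

(* Defs.v *)
From HB Require Import structures.
From mathcomp Require Import all_boot all_order all_algebra.
From mathcomp Require Import complex.
From mathcomp Require Import all_classical all_reals all_analysis.
From mathcomp Require Import measurable_realfun.
From mathcomp Require Import ring lra.

Set Implicit Arguments.
Unset Strict Implicit.
Unset Printing Implicit Defensive.

Import Order.TTheory GRing.Theory Num.Theory.
Import numFieldNormedType.Exports.

Local Open Scope classical_set_scope.
Local Open Scope ring_scope.
Local Open Scope complex_scope.

Local Notation Re := complex.Re.
Local Notation Im := complex.Im.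

Section HeisenbergGroup.
Variable A : comUnitRingType.

(* (z, y, x), in this order, is the matrix with rows (1 x z), (0 1 y), (0 0 1). *)
Definition heis_mx (z y x : A) : 'M[A]_3 :=
  \matrix_(i, j)
    nth 0 (nth [::] [:: [:: 1; x; z]; [:: 0; 1; y]; [:: 0; 0; 1]] i) j.

Definition heis_form : {pred 'M[A]_3} :=
  fun M => M == heis_mx (M 0 2%:R) (M 1 2%:R) (M 0 1).

Record heis := Heis { heis_val :> 'M[A]_3; _ : heis_form heis_val }.

HB.instance Definition _ := [isSub for heis_val].
HB.instance Definition _ := [Choice of heis by <:].

Definition hz (g : heis) : A := val g 0 2%:R.
Definition hy (g : heis) : A := val g 1 2%:R.
Definition hx (g : heis) : A := val g 0 1.

Lemma heis_mxP z y x : heis_form (heis_mx z y x).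
Proof. by rewrite /heis_form !mxE. Qed.

Definition heis_of z y x : heis := Heis (heis_mxP z y x).

Lemma heisE (g : heis) : g = heis_of (hz g) (hy g) (hx g).
Proof. by apply: val_inj; apply/eqP; case: g. Qed.

Lemma hz_of z y x : hz (heis_of z y x) = z. Proof. by rewrite /hz mxE. Qed.
Lemma hy_of z y x : hy (heis_of z y x) = y. Proof. by rewrite /hy mxE. Qed.
Lemma hx_of z y x : hx (heis_of z y x) = x. Proof. by rewrite /hx mxE. Qed.

Lemma heis_mxM z y x z' y' x' :
  heis_mx z y x *m heis_mx z' y' x' =
  heis_mx (z + z' + x * y') (y + y') (x + x').
Proof.
apply/matrixP=> i j; rewrite !mxE !big_ord_recl big_ord0 !mxE /=.
by case: i j => [[|[|[|//]]] ?] [[|[|[|//]]] ?] /=; ring.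
Qed.

Lemma heis_mulP (g h : heis) : heis_form (val g *m val h).
Proof.
by rewrite [g]heisE [h]heisE /= heis_mxM; exact: heis_mxP.
Qed.

Definition heis_mul (g h : heis) : heis := Heis (heis_mulP g h).

Lemma heis_mul_of z y x z' y' x' :
  heis_mul (heis_of z y x) (heis_of z' y' x') =
  heis_of (z + z' + x * y') (y + y') (x + x').
Proof. by apply: val_inj; rewrite /= heis_mxM. Qed.

Lemma heis_mx1 : heis_mx 0 0 0 = 1%:M.
Proof.
apply/matrixP=> i j; rewrite !mxE.
by case: i j => [[|[|[|//]]] ?] [[|[|[|//]]] ?].
Qed.

Lemma heis_oneP : heis_form 1%:M.
Proof. by rewrite -heis_mx1; exact: heis_mxP. Qed.

Definition heis_one : heis := Heis heis_oneP.

Lemma heis_oneE : heis_one = heis_of 0 0 0.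
Proof. by apply: val_inj; rewrite /= heis_mx1. Qed.

Lemma heis_invP (g : heis) : heis_form (invmx (val g)).
Proof.
rewrite [g]heisE /=; set z := hz g; set y := hy g; set x := hx g.
have E : heis_mx z y x *m heis_mx (x * y - z) (- y) (- x) = 1%:M.
  by rewrite heis_mxM -heis_mx1; congr heis_mx; ring.
have [U _] := mulmx1_unit E.
suff -> : invmx (heis_mx z y x) = heis_mx (x * y - z) (- y) (- x).
  exact: heis_mxP.
by rewrite -[LHS]mulmx1 -E mulKmx.
Qed.

Definition heis_inv (g : heis) : heis := Heis (heis_invP g).

Lemma heis_unit (g : heis) : val g \in unitmx.
Proof.
rewrite [g]heisE /=; set z := hz g; set y := hy g; set x := hx g.
have E : heis_mx z y x *m heis_mx (x * y - z) (- y) (- x) = 1%:M.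
  by rewrite heis_mxM -heis_mx1; congr heis_mx; ring.
by have [] := mulmx1_unit E.
Qed.

Lemma heis_mulA : associative heis_mul.
Proof. by move=> a b c; apply: val_inj; rewrite /= mulmxA. Qed.
Lemma heis_mul1 : left_id heis_one heis_mul.
Proof. by move=> a; apply: val_inj; rewrite /= mul1mx. Qed.
Lemma heis_mulr1 : right_id heis_one heis_mul.
Proof. by move=> a; apply: val_inj; rewrite /= mulmx1. Qed.
Lemma heis_mulV : left_inverse heis_one heis_inv heis_mul.
Proof. by move=> a; apply: val_inj; rewrite /= mulVmx// heis_unit. Qed.
Lemma heis_mulrV : right_inverse heis_one heis_inv heis_mul.
Proof. by move=> a; apply: val_inj; rewrite /= mulmxV// heis_unit. Qed.

HB.instance Definition _ :=
  isGroup.Build heis heis_mulA heis_mul1 heis_mulr1 heis_mulV heis_mulrV.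

Lemma heisM_coord (g h : heis) :
  [/\ hz (g * h)%g = hz g + hz h + hx g * hy h,
      hy (g * h)%g = hy g + hy h & hx (g * h)%g = hx g + hx h].
Proof.
have -> : (g * h)%g =
    heis_of (hz g + hz h + hx g * hy h) (hy g + hy h) (hx g + hx h).
  by rewrite {1}[g]heisE {1}[h]heisE; exact: heis_mul_of.
by rewrite hz_of hy_of hx_of.
Qed.

Lemma heis1_coord : [/\ hz (1%g : heis) = 0, hy (1%g : heis) = 0 &
  hx (1%g : heis) = 0].
Proof.
by have -> : (1%g : heis) = heis_of 0 0 0; [exact: heis_oneE|];
  rewrite hz_of hy_of hx_of.
Qed.

End HeisenbergGroup.

Section Inclusion.
Variable R : realType.

Lemma heis_inclP (g : heis int) : heis_form (map_mx (intr : int -> R) (val g)).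
Proof.
rewrite [g]heisE /=; rewrite (_ : map_mx _ _ =
  heis_mx (hz g)%:~R (hy g)%:~R (hx g)%:~R); first exact: heis_mxP.
apply/matrixP=> i j; rewrite !mxE.
by case: i j => [[|[|[|//]]] ?] [[|[|[|//]]] ?].
Qed.

Definition heis_incl (g : heis int) : heis R := Heis (heis_inclP g).

Lemma heis_inclM : {morph heis_incl : g h / (g * h)%g}.
Proof. by move=> g h; apply: val_inj; exact: map_mxM. Qed.

Lemma heis_incl_coord (g : heis int) :
  [/\ hz (heis_incl g) = (hz g)%:~R, hy (heis_incl g) = (hy g)%:~R &
      hx (heis_incl g) = (hx g)%:~R].
Proof. by rewrite /hz /hy /hx !mxE. Qed.
End Inclusion.

(* A Hilbert space is presented by a complex vector space with a positive
   semidefinite Hermitian form [hip], linear in its first argument; vectors are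
   identified when they differ by a null vector ([heq]).  For square-integrable
   functions [heq] is almost-everywhere equality, see [L2_heqP].  Accordingly,
   identities between vectors are required only up to [heq].  Completeness is
   not a field: it plays no role in unitary equivalence.  Throughout, [^*%C] is
   complex conjugation, ring_scope's [^*] being a different constant. *)
Record hermSpace (R : realType) := HermSpace {
  herm_sort :> lmodType R[i];
  hip : herm_sort -> herm_sort -> R[i];
  hip_linear : forall a u v w, hip (a *: u + v) w = a * hip u w + hip v w;
  hipC : forall u v, hip v u = (hip u v)^*%C;
  hip_ge0 : forall u, 0 <= hip u u }.

Definition heq (R : realType) (V : hermSpace R) (u v : V) :=
  hip (u - v) (u - v) = 0.

Section HermTheory.
Context (R : realType) (V : hermSpace R).
Implicit Types (a : R[i]) (u v w : V).

Lemma hip0l w : hip (0 : V) w = 0.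
Proof.
have := hip_linear 1 (0 : V) 0 w; rewrite scale1r addr0 mul1r.
by move=> /eqP; rewrite -subr_eq0 opprD addNKr oppr_eq0 => /eqP.
Qed.
Lemma hipDl u v w : hip (u + v) w = hip u w + hip v w.
Proof. by rewrite -{1}[u]scale1r hip_linear mul1r. Qed.
Lemma hipZl a u w : hip (a *: u) w = a * hip u w.
Proof. by rewrite -[a *: u]addr0 hip_linear hip0l addr0. Qed.
Lemma hipNl u w : hip (- u) w = - hip u w.
Proof. by rewrite -scaleN1r hipZl mulN1r. Qed.
Lemma hipDr u v w : hip w (u + v) = hip w u + hip w v.
Proof. by rewrite hipC hipDl rmorphD /= -!hipC. Qed.
Lemma hipZr a u w : hip w (a *: u) = a^*%C * hip w u.
Proof. by rewrite hipC hipZl rmorphM /= -hipC. Qed.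
Lemma hipNr u w : hip w (- u) = - hip w u.
Proof. by rewrite hipC hipNl rmorphN /= -hipC. Qed.
Lemma hip_suml (I : Type) (r : seq I) (P : pred I) (F : I -> V) w :
  hip (\sum_(i <- r | P i) F i) w = \sum_(i <- r | P i) hip (F i) w.
Proof. by apply: (big_morph (fun u => hip u w)) => [u v|]; rewrite ?hipDl ?hip0l. Qed.

Lemma heq_refl u : heq u u. Proof. by rewrite /heq subrr hip0l. Qed.
Lemma heq_eq u v : u = v -> heq u v. Proof. by move=> ->; exact: heq_refl. Qed.

Lemma Im_hip u : Im (hip u u) = 0.
Proof. exact/ger0_Im/hip_ge0. Qed.
Lemma Re_hip_ge0 u : 0 <= Re (hip u u).
Proof. by have := hip_ge0 u; rewrite lecE => /andP[]. Qed.
Lemma hip_Re u : hip u u = (Re (hip u u))%:C.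
Proof. by have := Im_hip u; case: (hip u u) => x y /= ->. Qed.

Lemma Re_hipC u v : Re (hip v u) = Re (hip u v).
Proof. by rewrite hipC; case: (hip u v). Qed.

Lemma Re_hipD u v : Re (hip (u + v) (u + v)) =
  Re (hip u u) + Re (hip v v) + 2 * Re (hip u v).
Proof.
rewrite hipDl !hipDr !raddfD /= (Re_hipC u v); ring.
Qed.

Lemma Re_hip_le u v :
  `|Re (hip u v)| <= Re (hip u u) + Re (hip v v).
Proof.
have := Re_hip_ge0 (u + v); rewrite Re_hipD => h1.
have := Re_hip_ge0 (u - v); rewrite Re_hipD hipNl hipNr hipNr opprK raddfN /= => h2.
have := Re_hip_ge0 u; have := Re_hip_ge0 v => h3 h4.
by rewrite ler_norml; apply/andP; split; lra.
Qed.

Lemma Re_hipZ a u : Re (hip (a *: u) (a *: u)) =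
  (Re a ^+ 2 + Im a ^+ 2) * Re (hip u u).
Proof.
rewrite hipZl hipZr (hip_Re u); case: a => x y /=; ring.
Qed.

Lemma Im_hip_le u v :
  `|Im (hip u v)| <= Re (hip u u) + Re (hip v v).
Proof.
have := Re_hip_le u ('i *: v).
rewrite hipZr Re_hipZ; case: (hip u v) => x y /=.
by rewrite expr0n expr1n add0r mul1r mul0r mulN1r opprK add0r.
Qed.

Lemma Re_hip_lin_le a u v : Re (hip (a *: u + v) (a *: u + v)) <=
  2 * (Re a ^+ 2 + Im a ^+ 2) * Re (hip u u) + 2 * Re (hip v v).
Proof.
have := Re_hip_ge0 (a *: u - v); rewrite !Re_hipD hipNl hipNr hipNr opprK.
by rewrite raddfN /= Re_hipZ; lra.
Qed.
End HermTheory.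

Record finHermSpace (R : realType) := FinHermSpace {
  fin_herm :> hermSpace R;
  hdim : nat;
  hbasis : 'I_hdim -> fin_herm;
  hbasis_ortho : forall i j, hip (hbasis i) (hbasis j) = (i == j)%:R;
  hbasisE : forall v, v = \sum_i hip v (hbasis i) *: hbasis i }.

Lemma hip_basis (R : realType) (V : finHermSpace R) (u v : V) :
  hip u v = \sum_(i < hdim V) hip u (hbasis i) * (hip v (hbasis i))^*%C.
Proof.
rewrite {1}[u]hbasisE hip_suml; apply: eq_bigr => i _.
by rewrite hipZl (hipC v).
Qed.

Definition cmeasurable_fun (R : realType) d (X : measurableType d)
    (D : set X) (f : X -> R[i]) :=
  measurable_fun D (fun x => Re (f x)) /\ measurable_fun D (fun x => Im (f x)).

Section CMeas.
Context (R : realType) d (X : measurableType d) (D : set X).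
Implicit Types f g : X -> R[i].

Lemma cmeasurable_cst (c : R[i]) : cmeasurable_fun D (fun=> c).
Proof. by split; exact: measurable_cst. Qed.

Lemma cmeasurableD f g : cmeasurable_fun D f -> cmeasurable_fun D g ->
  cmeasurable_fun D (fun x => f x + g x).
Proof.
move=> [f1 f2] [g1 g2]; split.
  under eq_fun do rewrite raddfD; exact: measurable_funD.
under eq_fun do rewrite raddfD; exact: measurable_funD.
Qed.

Lemma cmeasurableM f g : cmeasurable_fun D f -> cmeasurable_fun D g ->
  cmeasurable_fun D (fun x => f x * g x).
Proof.
move=> [f1 f2] [g1 g2]; split.
  rewrite (_ : (fun _ => _) = (fun x => Re (f x) * Re (g x)) \-
     (fun x => Im (f x) * Im (g x))); last first.
    by apply/funext=> x /=; case: (f x) (g x) => [? ?] [].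
  by apply: measurable_funB; exact: measurable_funM.
rewrite (_ : (fun _ => _) = (fun x => Re (f x) * Im (g x)) \+
   (fun x => Im (f x) * Re (g x))); last first.
  by apply/funext=> x /=; case: (f x) (g x) => [? ?] [].
by apply: measurable_funD; exact: measurable_funM.
Qed.

Lemma cmeasurableJ f : cmeasurable_fun D f ->
  cmeasurable_fun D (fun x => (f x)^*%C).
Proof.
move=> [f1 f2]; split.
  by rewrite (_ : (fun _ => _) = fun x => Re (f x))//; apply/funext => x; case: (f x).
rewrite (_ : (fun _ => _) = \- (fun x => Im (f x))); first exact: measurable_funN.
by apply/funext=> x /=; case: (f x).
Qed.

Lemma cmeasurable_sum (I : Type) (r : seq I) (F : I -> X -> R[i]) :
  (forall i, cmeasurable_fun D (F i)) ->
  cmeasurable_fun D (fun x => \sum_(i <- r) F i x).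
Proof.
move=> mF; elim: r => [|i r IH].
  by under eq_fun do rewrite big_nil; exact: cmeasurable_cst.
by under eq_fun do rewrite big_cons; exact: cmeasurableD.
Qed.
End CMeas.

Definition cintegral (R : realType) d (X : measurableType d)
    (mu : {measure set X -> \bar R}) (D : set X) (f : X -> R[i]) : R[i] :=
  (\int[mu]_(x in D) Re (f x)) +i* (\int[mu]_(x in D) Im (f x)).

Section L2.
Context (R : realType) d (X : measurableType d)
  (mu : {measure set X -> \bar R}) (D : set X) (mD : measurable D)
  (V : finHermSpace R).
Implicit Types f g : X -> V.

(* Measurable vector fields of the constant field V over D; V is
   finite-dimensional, so this is coordinatewise Borel measurability. *)
Definition measurable_section f :=
  forall v : V, cmeasurable_fun D (fun x => hip (f x) v).

Definition square_integrable f :=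
  mu.-integrable D (fun x => (Re (hip (f x) (f x)))%:E).

Lemma cmeasurable_hip f g : measurable_section f -> measurable_section g ->
  cmeasurable_fun D (fun x => hip (f x) (g x)).
Proof.
move=> mf mg; under eq_fun do rewrite hip_basis.
apply: cmeasurable_sum => i; apply: cmeasurableM; first exact: mf.
by apply: cmeasurableJ; exact: mg.
Qed.

Lemma measurable_section_lin a f g : measurable_section f ->
  measurable_section g -> measurable_section (fun x => a *: f x + g x).
Proof.
move=> mf mg v; under eq_fun do rewrite hip_linear.
apply: cmeasurableD; last exact: mg.
by apply: cmeasurableM; [exact: cmeasurable_cst|exact: mf].
Qed.

End L2.

Section L2Integrable.
Context (R : realType) d (X : measurableType d)
  (mu : {measure set X -> \bar R}) (D : set X) (mD : measurable D)
  (V : finHermSpace R).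
Implicit Types f g : X -> V.

Lemma integrable_hip f g :
  measurable_section D f -> square_integrable mu D f ->
  measurable_section D g -> square_integrable mu D g ->
  mu.-integrable D (fun x => (Re (hip (f x) (g x)))%:E) /\
  mu.-integrable D (fun x => (Im (hip (f x) (g x)))%:E).
Proof.
move=> mf sf mg sg; have [m1 m2] := cmeasurable_hip mf mg.
have sfg := integrableD mD sf sg.
split; apply: (le_integrable mD _ _ sfg); try exact/measurable_EFinP.
- move=> x _; rewrite /= lee_fin [leRHS]ger0_norm.
    exact: Re_hip_le.
  by rewrite addr_ge0// Re_hip_ge0.
- move=> x _; rewrite /= lee_fin [leRHS]ger0_norm.
    exact: Im_hip_le.
  by rewrite addr_ge0// Re_hip_ge0.
Qed.

Lemma square_integrable_lin a f g :
  measurable_section D f -> square_integrable mu D f ->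
  measurable_section D g -> square_integrable mu D g ->
  square_integrable mu D (fun x => a *: f x + g x).
Proof.
move=> mf sf mg sg.
have mfg := measurable_section_lin a mf mg.
have [m1 _] := cmeasurable_hip mfg mfg.
have sfg := integrableD mD (integrableZl mD (2 * (Re a ^+ 2 + Im a ^+ 2)) sf)
  (integrableZl mD 2 sg).
apply: (le_integrable mD _ _ sfg); first exact/measurable_EFinP.
move=> x _; rewrite /= lee_fin.
have h := Re_hip_lin_le a (f x) (g x).
have h0 := Re_hip_ge0 (a *: f x + g x).
by rewrite !ger0_norm// (le_trans h0).
Qed.

Lemma L2_0 : measurable_section D (fun=> 0 : V) /\
  square_integrable mu D (fun=> 0 : V).
Proof.
split.
  by move=> v; under eq_fun do rewrite hip0l; exact: cmeasurable_cst.
rewrite /square_integrable (_ : (fun _ => _) = cst 0%E); first exact: integrable0.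
by apply/funext => x; rewrite hip0l.
Qed.
End L2Integrable.

Section L2Space.
Context (R : realType) d (X : measurableType d)
  (mu : {measure set X -> \bar R}) (D : set X) (mD : measurable D)
  (V : finHermSpace R).

(* The unused proof argument lets the closure instance be inferred. *)
Definition L2_pred of measurable D : {pred X -> V} :=
  fun f => `[< measurable_section D f /\ square_integrable mu D f >].

Lemma L2_submod_closed : submod_closed (L2_pred mD).
Proof.
split; first by apply/asboolP; exact: L2_0.
move=> a f g /asboolP[mf sf] /asboolP[mg sg]; apply/asboolP; split.
  exact: measurable_section_lin.
exact: square_integrable_lin.
Qed.

HB.instance Definition _ :=
  GRing.isSubmodClosed.Build R[i] (X -> V) (L2_pred mD) L2_submod_closed.

Record L2_sort := L2Fun { L2_fun :> X -> V; _ : L2_fun \in L2_pred mD }.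

HB.instance Definition _ := [isSub for L2_fun].
HB.instance Definition _ := [Choice of L2_sort by <:].
HB.instance Definition _ := [SubChoice_isSubLmodule of L2_sort by <:].

Lemma L2_mem (f : L2_sort) :
  measurable_section D f /\ square_integrable mu D f.
Proof. by case: f => f /= /asboolP. Qed.

Definition L2_hip (f g : L2_sort) : R[i] :=
  cintegral mu D (fun x => hip (f x) (g x)).

Lemma L2_linE (a : R[i]) (f g : L2_sort) x : (a *: f + g) x = a *: f x + g x.
Proof. by []. Qed.

Lemma L2_hip_linear a (f g h : L2_sort) :
  L2_hip (a *: f + g) h = a * L2_hip f h + L2_hip g h.
Proof.
have [[mf sf] [[mg sg] [mh sh]]] := (L2_mem f, (L2_mem g, L2_mem h)).
have [rfh ifh] := integrable_hip mD mf sf mh sh.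
have [rgh igh] := integrable_hip mD mg sg mh sh.
have E (k : R) (F : X -> R) : mu.-integrable D (EFin \o F) ->
   mu.-integrable D (EFin \o (fun x => k * F x)).
  move=> /(integrableZl mD k) ?; rewrite (_ : _ \o _ = (fun x => (k%:E * (EFin \o F) x)%E))//.
rewrite /L2_hip /cintegral; case: a => a b /=.
apply/eqP; rewrite eq_complex; apply/andP; split; apply/eqP => /=.
- rewrite -!RintegralZl// -RintegralB ?E// -RintegralD//; last first.
    exact: (integrableB mD (E a _ rfh) (E b _ ifh)).
  by apply: eq_Rintegral => x _; rewrite hip_linear; case: (hip (f x) _) => ? ? /=; case: (hip (g x) _).
- rewrite -!RintegralZl// -RintegralD ?E// -RintegralD//; last first.
    exact: (integrableD mD (E a _ ifh) (E b _ rfh)).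
  by apply: eq_Rintegral => x _; rewrite hip_linear; case: (hip (f x) _) => ? ? /=; case: (hip (g x) _).
Qed.

Lemma L2_hipC (f g : L2_sort) : L2_hip g f = (L2_hip f g)^*%C.
Proof.
have [[mf sf] [mg sg]] := (L2_mem f, L2_mem g).
have [_ i] := integrable_hip mD mf sf mg sg.
rewrite /L2_hip /cintegral /=; congr (_ +i* _).
  by apply: eq_Rintegral => x _; rewrite Re_hipC.
rewrite -mulN1r -RintegralZl//; apply: eq_Rintegral => x _.
by rewrite hipC mulN1r; case: (hip _ _).
Qed.

Lemma L2_hip_ge0 (f : L2_sort) : 0 <= L2_hip f f.
Proof.
rewrite lecE /=; apply/andP; split; last first.
  by apply: Rintegral_ge0 => x _; exact: Re_hip_ge0.
apply/eqP; rewrite /Rintegral (eq_integral (cst 0%E)); last first.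
  by move=> x _; rewrite Im_hip.
by rewrite integral0.
Qed.

Definition L2 : hermSpace R :=
  @HermSpace R L2_sort L2_hip L2_hip_linear L2_hipC L2_hip_ge0.
End L2Space.

Record unitaryRep (R : realType) (G : groupType) (V : hermSpace R) :=
  UnitaryRep {
    ract :> G -> V -> V;
    ract_linear : forall g a u v,
      heq (ract g (a *: u + v)) (a *: ract g u + ract g v);
    ract_isometry : forall g u v, hip (ract g u) (ract g v) = hip u v;
    ract1 : forall u, heq (ract 1%g u) u;
    ractM : forall g h u, heq (ract (g * h)%g u) (ract g (ract h u)) }.

Section Restriction.
Context (R : realType) (G H : groupType) (V : hermSpace R).
Variables (phi : G -> H) (phiM : {morph phi : g h / (g * h)%g}).
Variable rho : unitaryRep H V.

Lemma restrict1 u : heq (rho (phi 1%g) u) u.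
Proof.
have -> : phi 1%g = 1%g.
  have := phiM 1%g 1%g; rewrite mulg1 => h.
  by rewrite -(mulKg (phi 1%g) (phi 1%g)) -h mulVg.
exact: ract1.
Qed.

Lemma restrictM g h u : heq (rho (phi (g * h)%g) u) (rho (phi g) (rho (phi h) u)).
Proof. by rewrite phiM; exact: ractM. Qed.

Definition restrict_rep : unitaryRep G V :=
  @UnitaryRep R G V (fun g => rho (phi g)) (fun g => ract_linear rho (phi g))
    (fun g => ract_isometry rho (phi g)) restrict1 restrictM.
End Restriction.

(* A linear, isometric and surjective map of the quotients by [heq]; it is
   well defined on classes because it is linear and isometric. *)
Definition unitary_map (R : realType) (V W : hermSpace R) (U : V -> W) :=
  [/\ forall a u v, heq (U (a *: u + v)) (a *: U u + U v),
      forall u v, hip (U u) (U v) = hip u v &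
      forall w, exists u, heq (U u) w].

Definition unitarily_equivalent (R : realType) (G : groupType)
    (V W : hermSpace R) (rho : unitaryRep G V) (sigma : unitaryRep G W) :=
  exists2 U : V -> W, unitary_map U &
    forall g u, heq (U (rho g u)) (sigma g (U u)).

Section DirectIntegral.
Context (R : realType) d (X : measurableType d)
  (mu : {measure set X -> \bar R}) (D : set X) (mD : measurable D)
  (G : groupType) (V : finHermSpace R) (rho : X -> unitaryRep G V).

(* A field of representations is measurable when it maps measurable vector
   fields to measurable vector fields. *)
Definition measurable_field := forall g (f : X -> V),
  measurable_section D f -> measurable_section D (fun x => rho x g (f x)).

Hypothesis mrho : measurable_field.

Lemma L2_heq (f g : L2 mu mD V) : (forall x, heq (f x) (g x)) -> heq f g.
Proof.
move=> fg; rewrite /heq /= /L2_hip /cintegral.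
rewrite /Rintegral [X in fine X +i* _](eq_integral (cst 0%E)); last first.
  by move=> x _; rewrite fg.
rewrite [X in _ +i* fine X](eq_integral (cst 0%E)); last first.
  by move=> x _; rewrite fg.
by rewrite integral0.
Qed.

Lemma dint_subproof g (f : L2 mu mD V) :
  (fun x => rho x g (f x)) \in L2_pred mu (V := V) mD.
Proof.
have [mf sf] := L2_mem f; apply/asboolP; split; first exact: mrho.
by rewrite /square_integrable; under eq_fun do rewrite ract_isometry.
Qed.

Definition dint_act g (f : L2 mu mD V) : L2 mu mD V := L2Fun (dint_subproof g f).

Lemma dint_linear g a (u v : L2 mu mD V) :
  heq (dint_act g (a *: u + v)) (a *: dint_act g u + dint_act g v).
Proof. by apply: L2_heq => x; exact: ract_linear. Qed.

Lemma dint_isometry g (u v : L2 mu mD V) :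
  hip (dint_act g u) (dint_act g v) = hip u v.
Proof.
rewrite /= /L2_hip /cintegral; congr (_ +i* _);
  by apply: eq_Rintegral => x _; rewrite /= ract_isometry.
Qed.

Lemma dint1 (u : L2 mu mD V) : heq (dint_act 1%g u) u.
Proof. by apply: L2_heq => x; exact: ract1. Qed.

Lemma dintM g h (u : L2 mu mD V) :
  heq (dint_act (g * h)%g u) (dint_act g (dint_act h u)).
Proof. by apply: L2_heq => x; exact: ractM. Qed.

Definition direct_integral : unitaryRep G (L2 mu mD V) :=
  UnitaryRep dint_linear dint_isometry dint1 dintM.
End DirectIntegral.

Section Expi.
Variable R : realType.

(* exp (i t) *)
Definition expi (t : R) : R[i] := cos t +i* sin t.

Lemma expi0 : expi 0 = 1. Proof. by rewrite /expi cos0 sin0. Qed.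
Lemma expiD s t : expi (s + t) = expi s * expi t.
Proof. by rewrite /expi cosD sinD; congr (_ +i* _); rewrite [RHS]addrC. Qed.

Lemma expiJ t : expi t * (expi t)^*%C = 1.
Proof.
rewrite /expi; apply/eqP; rewrite eq_complex /=.
by rewrite mulrN opprK -!expr2 cos2Dsin2 eqxx mulrN mulrC addNr eqxx.
Qed.

Lemma expi2pi (m : int) : expi (2 * pi * m%:~R) = 1.
Proof.
have h n : expi (2 * pi * n%:R) = 1.
  elim: n => [|n IH]; first by rewrite mulr0 expi0.
  rewrite -(natr1 n) mulrDr mulr1 expiD IH mul1r mulr_natl /expi.
  by rewrite cos2pi sin2pi.
case: m => n; first exact: h.
rewrite NegzE mulrNz mulrN.
have /= := expiD (- (2 * pi * n.+1%:R)) (2 * pi * n.+1%:R).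
by rewrite h addNr expi0 [RHS]mulr1 => <-.
Qed.

Lemma measurable_expi d (X : measurableType d) (D : set X) (u : X -> R) :
  measurable_fun D u -> cmeasurable_fun D (fun x => expi (u x)).
Proof.
move=> mu; split => /=.
  apply: (measurableT_comp _ mu); apply: continuous_measurable_fun.
  exact: continuous_cos.
apply: (measurableT_comp _ mu); apply: continuous_measurable_fun.
exact: continuous_sin.
Qed.
End Expi.

Section ComplexLine.
Variable R : realType.

Definition cline_hip (u v : R[i]) : R[i] := u * v^*%C.

Lemma cline_linear (a u v w : R[i]) :
  cline_hip (a *: u + v) w = a * cline_hip u w + cline_hip v w.
Proof. by rewrite /cline_hip mulrDl -mulrA. Qed.

Lemma cline_hipC (u v : R[i]) : cline_hip v u = (cline_hip u v)^*%C.
Proof. by rewrite /cline_hip rmorphM /= conjcK mulrC. Qed.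

Lemma cline_hip_ge0 (u : R[i]) : 0 <= cline_hip u u.
Proof. exact: mulcJ_ge0. Qed.

Definition cline_herm : hermSpace R :=
  @HermSpace R R[i] cline_hip cline_linear cline_hipC cline_hip_ge0.

Let cone : cline_herm := (1 : R[i]).

Lemma cline_ortho (i j : 'I_1) :
  hip cone cone = (i == j)%:R.
Proof. by rewrite !ord1 /= /cline_hip /cone conjc1 mulr1. Qed.

Lemma cline_basisE (v : cline_herm) :
  v = \sum_(i < 1) hip v cone *: cone.
Proof.
rewrite big_ord1 /= /cline_hip /cone conjc1 mulr1; exact/esym/mulr1.
Qed.

Definition cline : finHermSpace R :=
  @FinHermSpace R cline_herm 1 (fun=> cone) cline_ortho cline_basisE.
End ComplexLine.

Lemma finherm_definite (R : realType) (V : finHermSpace R) (v : V) :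
  hip v v = 0 -> v = 0.
Proof.
rewrite hip_basis => /eqP; rewrite psumr_eq0; last first.
  by move=> i _; exact: mulcJ_ge0.
move=> /allP v0; rewrite [LHS]hbasisE big1// => i _.
have /implyP/(_ isT) := v0 i (mem_index_enum _).
by rewrite mulf_eq0 conjc_eq0 orbb => /eqP ->; rewrite scale0r.
Qed.

Lemma L2_heqP (R : realType) d (X : measurableType d)
    (mu : {measure set X -> \bar R}) (D : set X) (mD : measurable D)
    (V : finHermSpace R) (f g : L2 mu mD V) :
  heq f g <-> {ae mu, forall x, D x -> f x = g x}.
Proof.
have [m1 s1] := L2_mem (f - g : L2_sort mu mD V).
have E : heq f g <-> (\int[mu]_(x in D)
    `|(Re (hip ((f - g : L2_sort mu mD V) x) ((f - g : L2_sort mu mD V) x)))%:E| = 0)%E.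
  rewrite (_ : heq f g = (L2_hip (f - g : L2_sort mu mD V) (f - g) = 0))//.
  have -> : L2_hip (f - g : L2_sort mu mD V) (f - g) =
      (\int[mu]_(x in D) Re (hip ((f - g : L2_sort mu mD V) x) ((f - g : L2_sort mu mD V) x)))%:C%C.
    exact: (@hip_Re R (L2 mu mD V) (f - g)).
  rewrite (eq_integral (fun x => (Re (hip ((f - g : L2_sort mu mD V) x)
     ((f - g : L2_sort mu mD V) x)))%:E)); last first.
    by move=> x _; rewrite gee0_abs// lee_fin Re_hip_ge0.
  rewrite /Rintegral; split=> [[h]|->//].
  by rewrite -[LHS]fineK ?h ?(integrable_fin_num mD s1).
rewrite E ae_eq_integral_abs//; last by case/integrableP: s1.
split; apply: filterS => x h Dx; have := h Dx.
- move=> [h0]; apply/eqP; rewrite -subr_eq0; apply/eqP/finherm_definite.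
  by rewrite hip_Re; congr (_%:C)%C.
- move=> fg; congr EFin.
  rewrite (_ : (f - g : L2_sort mu mD V) x = f x - g x)// fg subrr hip0l.
  by [].
Qed.

Section Translation.
Variable R : realType.
Local Notation leb := (@lebesgue_measure R).
Let shift (a : R) (s : measurableTypeR R) : measurableTypeR R := s + a.

Lemma measurable_shift (a : R) : measurable_fun [set: measurableTypeR R] (shift a).
Proof.
apply: (@continuous_measurable_fun R (fun s => s + a)) => x.
by apply: continuousD; [exact: cvg_id|exact: cvg_cst].
Qed.

Lemma lebesgue_shift (a : R) (A : set (measurableTypeR R)) : measurable A ->
  leb A = pushforward leb (shift a) A.
Proof.
apply: (lebesgue_measure_unique (mu :=
  measure_function_pushforward__canonical__measure_function_Measure leb
    (measurable_shift a))) => _ [[x y] _ <-].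
rewrite /= /pushforward.
have -> : shift a @^-1` [set` `]x, y]] = [set` `]x - a, y - a]] :> set R.
  by apply/seteqP; split=> s /=; rewrite !in_itv /= /shift ltrBlDr lerBrDr.
rewrite !lebesgue_measure_itv /= !lte_fin ltrD2r.
by case: ifP => // _; rewrite -!EFinB; congr EFin; lra.
Qed.

Lemma ge0_integral_shift (a : R) (F : measurableTypeR R -> \bar R) :
  measurable_fun setT F -> (forall s, 0 <= F s)%E ->
  (\int[leb]_s F (shift a s) = \int[leb]_s F s)%E.
Proof.
move=> mF F0.
rewrite -[LHS](ge0_integral_pushforward (measurable_shift a) leb (D := setT) (f := F))//.
apply: (@eq_measure_integral _ _ _ _ leb
 (measure_function_pushforward__canonical__measure_function_Measure leb
    (measurable_shift a)) F) => A mA _ /=.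
by rewrite [RHS](lebesgue_shift a).
Qed.

Lemma integrable_shift (a : R) (F : measurableTypeR R -> \bar R) :
  leb.-integrable setT F -> leb.-integrable setT (fun s => F (shift a s)).
Proof.
move=> /integrableP[mF iF]; apply/integrableP; split.
  by apply: (measurableT_comp mF); exact: measurable_shift.
rewrite (ge0_integral_shift a (F := fun s => `|F s|%E))//.
exact: measurableT_comp.
Qed.

Lemma Rintegral_shift (a : R) (F : measurableTypeR R -> R) :
  leb.-integrable setT (EFin \o F) ->
  \int[leb]_s F (shift a s) = \int[leb]_s F s.
Proof.
move=> iF; have /integrableP[mF _] := iF.
rewrite /Rintegral; congr fine.
rewrite -[LHS](integral_pushforward (measurable_shift a) (mu := leb) (D := setT) (f := EFin \o F))//.
  apply: (@eq_measure_integral _ _ _ _ leb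
   (measure_function_pushforward__canonical__measure_function_Measure leb
      (measurable_shift a)) (EFin \o F)) => A mA _ /=.
  by rewrite [RHS](lebesgue_shift a).
exact: integrable_shift.
Qed.
End Translation.

(* Complex-valued L^2 of the real line: [cline] is C with <u, v> = u v^*. *)
Definition L2R (R : realType) : hermSpace R :=
  L2 (@lebesgue_measure R) measurableT (cline R).

Section Schrodinger.
Variables (R : realType) (h : R).
Implicit Types (g : heis R) (f : L2R R).

Definition schrodinger_fun g (f : measurableTypeR R -> cline R)
    (s : measurableTypeR R) : cline R :=
  expi (2 * pi * h * (hz g + s * hy g)) * f (s + hx g).

Lemma schrodinger_hip g (u v : measurableTypeR R -> cline R) s :
  hip (schrodinger_fun g u s) (schrodinger_fun g v s) =
  hip (u (s + hx g)) (v (s + hx g)).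
Proof.
rewrite /= /cline_hip /schrodinger_fun rmorphM /= mulrACA.
by rewrite expiJ mul1r.
Qed.

Lemma schrodinger_subproof g f :
  schrodinger_fun g f \in
    L2_pred (@lebesgue_measure R) (V := cline R) measurableT.
Proof.
have [mf sf] := L2_mem f; apply/asboolP; split; last first.
  rewrite /square_integrable; under eq_fun do rewrite schrodinger_hip.
  exact: (integrable_shift (hx g) sf).
move=> v.
rewrite (_ : (fun x => _) = fun s : measurableTypeR R =>
   expi (2 * pi * h * (hz g + s * hy g)) * hip (f (s + hx g)) v); last first.
  by apply/funext => s; rewrite /schrodinger_fun /= /cline_hip mulrA.
apply: cmeasurableM.
  apply: measurable_expi; apply: measurable_funM; first exact: measurable_cst.
  apply: measurable_funD; first exact: measurable_cst.
  by apply: measurable_funM; [exact: measurable_id|exact: measurable_cst].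
have [m1 m2] := mf v.
split.
  exact: (measurableT_comp m1 (measurable_shift (hx g))).
exact: (measurableT_comp m2 (measurable_shift (hx g))).
Qed.

Definition schrodinger_act g f : L2R R := L2Fun (schrodinger_subproof g f).

Lemma schrodinger_linear g a (u v : L2R R) :
  heq (schrodinger_act g (a *: u + v))
      (a *: schrodinger_act g u + schrodinger_act g v).
Proof.
apply: L2_heq => s; apply: heq_eq.
have E (e x y : R[i]) : e * (a * x + y) = a * (e * x) + e * y by ring.
exact: E.
Qed.

Lemma schrodinger_isometry g (u v : L2R R) :
  hip (schrodinger_act g u) (schrodinger_act g v) = hip u v.
Proof.
have [[mu su] [mv sv]] := (L2_mem u, L2_mem v).
have [i1 i2] := integrable_hip measurableT mu su mv sv.
rewrite /= /L2_hip /cintegral -(Rintegral_shift (hx g) i1) -(Rintegral_shift (hx g) i2).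
congr (_ +i* _); by apply: eq_Rintegral => s _; rewrite schrodinger_hip.
Qed.

Lemma schrodinger1 (u : L2R R) : heq (schrodinger_act 1%g u) u.
Proof.
apply: L2_heq => s; apply: heq_eq.
rewrite /= /schrodinger_fun; have [-> -> ->] := heis1_coord R.
by rewrite mulr0 !addr0 mulr0 expi0 mul1r.
Qed.

Lemma schrodingerM g g' (u : L2R R) :
  heq (schrodinger_act (g * g')%g u)
      (schrodinger_act g (schrodinger_act g' u)).
Proof.
apply: L2_heq => s; apply: heq_eq.
rewrite /= /schrodinger_fun; have [-> -> ->] := heisM_coord g g'.
rewrite mulrA -expiD addrA; congr (expi _ * _); ring.
Qed.

Definition schrodinger : unitaryRep (heis R) (L2R R) :=
  UnitaryRep schrodinger_linear schrodinger_isometry schrodinger1 schrodingerM.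
End Schrodinger.

Section PeriodicSequences.
Variables (R : realType) (q : nat).

Definition periodic_pred : {pred int -> R[i]} :=
  fun phi => `[< forall k, phi (k + q%:Z) = phi k >].

Lemma periodic_submod : submod_closed periodic_pred.
Proof.
split; first exact/asboolP.
move=> a f g /asboolP pf /asboolP pg; apply/asboolP => k.
by rewrite [LHS]/GRing.add /= /GRing.scale /= pf pg.
Qed.

HB.instance Definition _ :=
  GRing.isSubmodClosed.Build R[i] (int -> R[i]) periodic_pred periodic_submod.

Record pseq := PSeq { pseq_fun :> int -> R[i]; _ : pseq_fun \in periodic_pred }.

HB.instance Definition _ := [isSub for pseq_fun].
HB.instance Definition _ := [Choice of pseq by <:].
HB.instance Definition _ := [SubChoice_isSubLmodule of pseq by <:].

Lemma pseqP (phi : pseq) k : phi (k + q%:Z) = phi k.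
Proof. by case: phi => f /= /asboolP. Qed.

Lemma pseq_mul (phi : pseq) k (m : int) : phi (k + m * q%:Z) = phi k.
Proof.
elim: m k => [|m IH|m IH] k; first by rewrite mul0r addr0.
  by rewrite intS mulrDl mul1r addrA IH pseqP.
by rewrite intS opprD mulrDl addrA IH mulN1r -[in RHS](subrK q%:Z k) pseqP.
Qed.

Lemma pseq_mod (phi : pseq) k : phi (k %% q%:Z)%Z = phi k.
Proof. by rewrite {2}(divz_eq k q%:Z) addrC pseq_mul. Qed.

(* The l^2 inner product over one period, for which every [rho_fin] is unitary. *)
Definition pseq_hip (phi psi : pseq) : R[i] :=
  \sum_(k < q) phi k%:Z * (psi k%:Z)^*%C.

Lemma pseq_hip_linear a (u v w : pseq) :
  pseq_hip (a *: u + v) w = a * pseq_hip u w + pseq_hip v w.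
Proof.
rewrite /pseq_hip mulr_sumr -big_split /=; apply: eq_bigr => k _.
have E (x y z : R[i]) : (a * x + y) * z = a * (x * z) + y * z by ring.
exact: E.
Qed.

Lemma pseq_hipC (u v : pseq) : pseq_hip v u = (pseq_hip u v)^*%C.
Proof.
rewrite /pseq_hip rmorph_sum /=; apply: eq_bigr => k _.
by rewrite rmorphM /= conjcK mulrC.
Qed.

Lemma pseq_hip_ge0 (u : pseq) : 0 <= pseq_hip u u.
Proof. by apply: sumr_ge0 => k _; exact: mulcJ_ge0. Qed.

Definition pseq_herm : hermSpace R :=
  @HermSpace R pseq pseq_hip pseq_hip_linear pseq_hipC pseq_hip_ge0.

Lemma pseq_delta_subproof (i : 'I_q) :
  (fun k : int => ((k == i%:Z %[mod q%:Z])%Z)%:R) \in periodic_pred.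
Proof. by apply/asboolP => k; rewrite modzDr. Qed.

Definition pseq_delta (i : 'I_q) : pseq_herm := PSeq (pseq_delta_subproof i).

Lemma pseq_deltaE (i k : 'I_q) : (pseq_delta i : pseq) k%:Z = (k == i)%:R.
Proof. by rewrite /= !modz_nat !modn_small. Qed.

Lemma pseq_hip_delta (u : pseq) (i : 'I_q) : pseq_hip u (pseq_delta i) = u i%:Z.
Proof.
rewrite /pseq_hip (bigD1 i)//= !modz_nat eqxx conjc1 mulr1 big1 ?addr0// => k ki.
by rewrite !modz_nat !modn_small// [_ == _ :> int](_ : _ = (k == i))// (negbTE ki) conjc0 mulr0.
Qed.

Lemma pseq_ortho (i j : 'I_q) :
  hip (pseq_delta i) (pseq_delta j) = (i == j)%:R.
Proof.
by rewrite [LHS]pseq_hip_delta pseq_deltaE eq_sym.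
Qed.

Lemma pseq_eq (u v : pseq) : (forall k, u k = v k) -> u = v.
Proof. by move=> uv; apply: val_inj; apply/funext. Qed.

Lemma pseq_sumE (F : 'I_q -> pseq) k : (\sum_i F i : pseq) k = \sum_i F i k.
Proof. by elim/big_rec2 : _ => // i y z _ <-. Qed.

Hypothesis q_gt0 : (0 < q)%N.

Lemma pseq_basisE (v : pseq_herm) :
  v = \sum_i hip v (pseq_delta i) *: pseq_delta i.
Proof.
apply: pseq_eq => k; rewrite pseq_sumE.
have qp : 0 < q%:Z by rewrite ltz_nat.
have q0 : q%:Z != 0 by rewrite gt_eqF.
have kq : (`|(k %% q%:Z)%Z| < q)%N.
  by rewrite -ltz_nat gez0_abs ?modz_ge0 ?ltz_pmod.
rewrite (bigD1 (Ordinal kq))//= big1 ?addr0 => [|i ik].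
  rewrite [LHS](_ : _ = pseq_hip v (pseq_delta (Ordinal kq)) * ((k == `|(k %% q%:Z)%Z|%:Z %[mod q%:Z])%Z)%:R)//.
  by rewrite pseq_hip_delta /= gez0_abs ?modz_ge0// modz_mod eqxx mulr1 pseq_mod.
rewrite [LHS](_ : _ = pseq_hip v (pseq_delta i) * ((k == i%:Z %[mod q%:Z])%Z)%:R)//.
rewrite (_ : (_ == _ %[mod _])%Z = false) ?mulr0//.
apply/negbTE; apply: contra ik => /eqP ki; apply/eqP/val_inj => /=.
by rewrite ki modz_nat modn_small.
Qed.

Definition pseq_space : finHermSpace R :=
  @FinHermSpace R pseq_herm q pseq_delta pseq_ortho pseq_basisE.
End PeriodicSequences.

Section RhoFin.
Variables (R : realType) (x1 : rat).

(* The q of x1 = p/q in lowest terms. *)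
Definition qden : nat := `|denq x1|%N.

Lemma qden_gt0 : (0 < qden)%N.
Proof. by rewrite absz_gt0 denq_neq0. Qed.

Lemma qdenM : qden%:R * ratr x1 = (numq x1)%:~R :> R.
Proof.
rewrite /ratr mulrC natr_absz gtr0_norm ?denq_gt0// divfK//.
by rewrite intr_eq0 denq_neq0.
Qed.

Definition fin_space : finHermSpace R := pseq_space R qden_gt0.

Section Field.
Variables x2 x3 : R.

Definition rho_fin_phase (n : heis int) (k : int) : R[i] :=
  expi (2 * pi / qden%:R *
    ((hx n)%:~R * x3 + (hy n)%:~R * x2 + (hz n)%:~R * qden%:R * ratr x1
       + k%:~R * (hy n)%:~R * qden%:R * ratr x1)).

Definition rho_fin_fun (n : heis int) (phi : int -> R[i]) (k : int) : R[i] :=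
  rho_fin_phase n k * phi (k + hx n).

Lemma rho_fin_subproof n (phi : pseq R qden) :
  rho_fin_fun n phi \in periodic_pred qden.
Proof.
apply/asboolP => k; rewrite /rho_fin_fun addrAC pseqP; congr (_ * _).
rewrite /rho_fin_phase.
have q0 : qden%:R != 0 :> R by rewrite pnatr_eq0 -lt0n qden_gt0.
rewrite -[RHS]mulr1 -(expi2pi R (hy n * numq x1)) -expiD; congr expi.
rewrite !intrM -qdenM intrD; field; exact: q0.
Qed.

Definition rho_fin_act n (phi : fin_space) : fin_space :=
  PSeq (rho_fin_subproof n phi).

Lemma rho_fin_linear n a (u v : fin_space) :
  heq (rho_fin_act n (a *: u + v)) (a *: rho_fin_act n u + rho_fin_act n v).
Proof.
apply: heq_eq; apply: pseq_eq => k.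
have E (e x y : R[i]) : e * (a * x + y) = a * (e * x) + e * y by ring.
exact: E.
Qed.

Lemma sum_shift (F : int -> R[i]) (m : int) :
  (forall k, F (k + qden%:Z) = F k) ->
  \sum_(k < qden) F (k%:Z + m) = \sum_(k < qden) F k%:Z.
Proof.
have S (G : int -> R[i]) : (forall k, G (k + qden%:Z) = G k) ->
    \sum_(k < qden) G (k%:Z + 1) = \sum_(k < qden) G k%:Z.
  move=> pG; apply: (@addIr _ (G 0)).
  have E : \sum_(i < qden.+1) G (i : nat)%:Z =
      \sum_(i < qden) G (i : nat)%:Z + G qden%:Z by rewrite big_ord_recr.
  have G0 : G qden%:Z = G 0 by rewrite -[qden%:Z]add0r pG.
  rewrite -{}G0 -{}E big_ord_recl /= addrC -[qden%:Z]add0r pG.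
  by congr (_ + _); apply: eq_bigr => k _; rewrite /bump /= addrC.
move=> pF; have pFm j k : F (k + qden%:Z + j) = F (k + j).
  by rewrite addrAC pF.
elim: m => [|m IH|m IH]; first by apply: eq_bigr => k _; rewrite addr0.
  rewrite -IH -(S (fun k => F (k + m%:Z)) (pFm _)); apply: eq_bigr => k _.
  by rewrite intS addrA.
rewrite -IH -(S (fun k => F (k - m.+1%:Z)) (pFm _)); apply: eq_bigr => k _.
by rewrite intS opprD addrA addrK.
Qed.

Lemma rho_fin_isometry n (u v : fin_space) :
  hip (rho_fin_act n u) (rho_fin_act n v) = hip u v.
Proof.
rewrite [RHS]/= /pseq_hip -(@sum_shift (fun k => (u : pseq _ _) k * ((v : pseq _ _) k)^*%C) (hx n)); last first.
  by move=> k; rewrite !pseqP.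
apply: eq_bigr => k _.
by rewrite /= /rho_fin_fun rmorphM /= mulrACA expiJ mul1r.
Qed.

Lemma rho_fin1 (u : fin_space) : heq (rho_fin_act 1%g u) u.
Proof.
apply: heq_eq; apply: pseq_eq => k.
rewrite /= /rho_fin_fun /rho_fin_phase; have [-> -> ->] := heis1_coord int.
by rewrite addr0 !mul0r mulr0 !mul0r !addr0 mulr0 expi0 mul1r.
Qed.

Lemma rho_finM n n' (u : fin_space) :
  heq (rho_fin_act (n * n')%g u) (rho_fin_act n (rho_fin_act n' u)).
Proof.
apply: heq_eq; apply: pseq_eq => k.
rewrite /= /rho_fin_fun /rho_fin_phase; have [-> -> ->] := heisM_coord n n'.
rewrite mulrA -expiD addrA; congr (expi _ * _).
rewrite !(intrD, intrM); ring.
Qed.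

Definition rho_fin : unitaryRep (heis int) fin_space :=
  UnitaryRep rho_fin_linear rho_fin_isometry rho_fin1 rho_finM.
End Field.

Lemma measurable_rho_fin d (X : measurableType d) (D : set X) (x2 x3 : X -> R) :
  measurable_fun D x2 -> measurable_fun D x3 ->
  measurable_field D (fun x => rho_fin (x2 x) (x3 x)).
Proof.
move=> m2 m3 n f mf v.
apply: cmeasurable_sum => k; apply: cmeasurableM; last exact: cmeasurable_cst.
apply: cmeasurableM.
  apply: measurable_expi; apply: measurable_funM; first exact: measurable_cst.
  do 2 (apply: measurable_funD; last exact: measurable_cst).
  by apply: measurable_funD; apply: measurable_funM => //; exact: measurable_cst.
rewrite (_ : (fun x => _) = fun x => hip (f x) (pseq_delta R
   (Ordinal (ltn_pmod `|((k%:Z + hx n) %% qden%:Z)%Z|%N qden_gt0)))).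
  exact: mf.
apply/funext => x; rewrite [RHS]pseq_hip_delta /= modn_small; last first.
  by rewrite -ltz_nat gez0_abs ?modz_ge0 ?ltz_pmod ?ltz_nat ?qden_gt0// gt_eqF// ltz_nat qden_gt0.
by rewrite gez0_abs ?modz_ge0 ?pseq_mod// gt_eqF// ltz_nat qden_gt0.
Qed.
End RhoFin.

Section UnitSquare.
Variable R : realType.

Definition fracpart (a : R) : R := a - (Num.floor a)%:~R.

(* Points are x = (x2, x3). *)
Definition square01 : set (measurableTypeR R * measurableTypeR R) :=
  `[0, 1]%classic `*` `[0, 1]%classic.

Lemma measurable_square01 : measurable square01.
Proof. by apply: measurableX; exact: measurable_itv. Qed.

Lemma measurable_frac_fst (c : R) :
  measurable_fun square01 (fun x => fracpart (c * x.1)).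
Proof.
have mc : measurable_fun square01 (fun x => c * x.1 : R).
  apply: measurable_funM; first exact: measurable_cst.
  exact: measurable_funS measurable_fst.
apply: measurable_funB => //.
apply: (@measurableT_comp _ _ _ _ _ _ (fun a : R => (Num.floor a)%:~R : R)) mc.
apply: nondecreasing_measurable => // a b ab.
by rewrite ler_int le_floor.
Qed.

Lemma measurable_rho_fin_frac (x1 : rat) (c : R) :
  measurable_field square01 (fun x => rho_fin x1 (fracpart (c * x.1)) x.2).
Proof.
apply: measurable_rho_fin; first exact: measurable_frac_fst.
exact: measurable_funS measurable_snd.
Qed.
End UnitSquare.

(* Main.v *)
(* The intertwiner is a Zak transform. For u of bounded support on the line put
     (Z u)(t, x) = \sum_j u(t + j) exp(-2 i pi x j / q) delta_(j + c(t)),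
   where delta_k is the indicator of k + qZ and c(t) = a [p t] with a p = 1 mod q.
   Shifting u by n_3 reindexes the sum, giving the factor exp(2 i pi n_3 x / q),
   while multiplication by exp(2 i pi (p/q) s n_2) at s = t + j becomes
   exp(2 i pi n_2 ({p t} + k p) / q) at k = j + c(t) mod q; so Z intertwines the two
   representations. Integrating first in x, orthogonality of the exponentials
   shows that Z is isometric. If w is orthogonal to the range of Z, testing
   against u(t + j) = 1_A(t) for the single j = k - c(t) + q m shows that, up to a
   unimodular factor, the k-th coordinate of w has zero integral against every
   1_A(t) exp(2 i pi m x), so that it vanishes almost everywhere. As both L^2 spaces
   are complete, Z extends to a unitary map. *)
Require Import Defs.
From mathcomp Require Import all_boot all_order all_algebra.
From mathcomp Require Import complex.
From mathcomp Require Import all_classical all_reals all_analysis.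
From mathcomp Require Import measurable_realfun.
From mathcomp Require Import ring lra.

Set Implicit Arguments.
Unset Strict Implicit.
Unset Printing Implicit Defensive.

Import Order.TTheory GRing.Theory Num.Theory.
Import numFieldNormedType.Exports.

Local Open Scope classical_set_scope.
Local Open Scope ring_scope.

Local Notation Re := complex.Re.
Local Notation Im := complex.Im.

Lemma cvgr_lin {R : realType} (a b : R) (x y : nat -> R) (l m : R) :
  x @ \oo --> l -> y @ \oo --> m ->
  (fun n => a * x n + b * y n) @ \oo --> a * l + b * m.
Proof. by move=> xl ym; apply: cvgD; apply: cvgM => //; exact: cvg_cst. Qed.

Section SquaredNorm.
Context {R : realType} {V : hermSpace R}.
Implicit Types (u v w : V) (a : R[i]).

Definition nsq u : R := Re (hip u u).

Definition hcvg (u_ : nat -> V) u := (fun n => nsq (u_ n - u)) @ \oo --> (0 : R).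

Definition hcauchy (u_ : nat -> V) := forall e : R, 0 < e ->
  exists N, forall m n, (N <= m)%N -> (N <= n)%N -> nsq (u_ m - u_ n) < e.

Lemma nsq_ge0 u : 0 <= nsq u. Proof. exact: Re_hip_ge0. Qed.

Lemma heqE u v : heq u v <-> nsq (u - v) = 0.
Proof. by rewrite /heq /nsq; split=> [->//|h]; rewrite hip_Re h. Qed.

Lemma nsqD u v : nsq (u + v) = nsq u + nsq v + 2 * Re (hip u v).
Proof. exact: Re_hipD. Qed.

Lemma nsqZ a u : nsq (a *: u) = (Re a ^+ 2 + Im a ^+ 2) * nsq u.
Proof. exact: Re_hipZ. Qed.

Lemma nsqN u : nsq (- u) = nsq u.
Proof. by rewrite /nsq hipNl hipNr opprK. Qed.

Lemma nsq0 : nsq (0 : V) = 0.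
Proof. by rewrite /nsq hip0l. Qed.

Lemma nsqBC u v : nsq (u - v) = nsq (v - u).
Proof. by rewrite -nsqN opprB. Qed.

Lemma nsq_lin_le a u v : nsq (a *: u + v) <=
  2 * (Re a ^+ 2 + Im a ^+ 2) * nsq u + 2 * nsq v.
Proof. exact: Re_hip_lin_le. Qed.

Lemma nsqD_le u v : nsq (u + v) <= 2 * nsq u + 2 * nsq v.
Proof.
have := nsq_lin_le 1 u v; rewrite scale1r => /le_trans; apply.
by rewrite /= expr1n expr0n /= addr0 mulr1.
Qed.

Lemma nsq_tri u v w : nsq (u - w) <= 2 * nsq (u - v) + 2 * nsq (v - w).
Proof. by rewrite -(subrKA v u); exact: nsqD_le. Qed.

Lemma Re_hipZl (t : R) u v : Re (hip (t%:C%C *: u) v) = t * Re (hip u v).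
Proof. by rewrite hipZl; case: (hip u v) => x y /=; rewrite mul0r subr0. Qed.

Lemma Im_hipE u v : Im (hip u v) = Re (hip u (Complex 0 1 *: v)).
Proof. by rewrite hipZr; case: (hip _ _) => x y /=; ring. Qed.

Lemma hip_cauchy_schwarz u v : Re (hip u v) ^+ 2 <= nsq u * nsq v.
Proof.
have q (s t : R) : 0 <= s ^+ 2 * nsq u + t ^+ 2 * nsq v + 2 * s * t * Re (hip u v).
  have := nsq_ge0 (s%:C%C *: u + t%:C%C *: v).
  rewrite nsqD !nsqZ /= expr0n /= !addr0 Re_hipZl Re_hipC Re_hipZl Re_hipC.
  by rewrite !mulrA.
have [v0|v0] := eqVneq (nsq v) 0.
  rewrite v0 mulr0; have [->|r0] := eqVneq (Re (hip u v)) 0; first by rewrite expr0n.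
  have := q 1 (- (nsq u + 1) / (2 * Re (hip u v))).
  rewrite v0 (_ : _ + _ = -1); last by field.
  by rewrite ler0N1.
have := q (nsq v) (- Re (hip u v)); have v1 : 0 < nsq v by rewrite lt0r v0 nsq_ge0.
rewrite (_ : _ + _ = nsq v * (nsq u * nsq v - Re (hip u v) ^+ 2)); last by ring.
by rewrite pmulr_rge0// subr_ge0.
Qed.

Lemma hcvg_Re_hip (u_ : nat -> V) u v : hcvg u_ u ->
  (fun n => Re (hip (u_ n - u) v)) @ \oo --> (0 : R).
Proof.
move=> uu; apply/norm_cvg0P.
apply: (@squeeze_cvgr _ _ _ _ (cst 0) (fun n => Num.sqrt (nsq (u_ n - u) * nsq v))).
- apply: nearW => n; rewrite normr_ge0 /= -sqrtr_sqr.
  by rewrite ler_wsqrtr// hip_cauchy_schwarz.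
- exact: cvg_cst.
- rewrite -(@sqrtr0 R); apply: continuous_cvg; first exact: sqrt_continuous.
  rewrite -(mul0r (nsq v)); apply: cvgM => //; exact: cvg_cst.
Qed.

Lemma hcvg_nsq (u_ : nat -> V) u : hcvg u_ u -> (fun n => nsq (u_ n)) @ \oo --> nsq u.
Proof.
move=> uu.
rewrite (_ : (fun n => _) =
  fun n => nsq u + (1 * nsq (u_ n - u) + 2 * Re (hip (u_ n - u) u))); last first.
  by apply/funext => n; rewrite mul1r addrA [nsq u + _]addrC -nsqD subrK.
have := cvgD (cvg_cst (nsq u)) (@cvgr_lin _ 1 2 _ _ _ _ uu (hcvg_Re_hip u uu)).
by rewrite !mulr0 !addr0; apply.
Qed.

Lemma heq_nsq u v : heq u v -> nsq u = nsq v.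
Proof.
move=> /heqE uv; have /hcvg_nsq h : hcvg (fun=> u) v.
  by rewrite /hcvg uv; exact: cvg_cst.
exact: (cvg_unique (@Rhausdorff _) (cvg_cst (nsq u)) h).
Qed.

Lemma hcvg_lin a (u_ v_ : nat -> V) u v : hcvg u_ u -> hcvg v_ v ->
  hcvg (fun n => a *: u_ n + v_ n) (a *: u + v).
Proof.
move=> uu vv.
apply: (@squeeze_cvgr _ _ _ _ (cst 0) (fun n =>
  2 * (Re a ^+ 2 + Im a ^+ 2) * nsq (u_ n - u) + 2 * nsq (v_ n - v))).
- apply: nearW => n; rewrite nsq_ge0 /= (le_trans _ (nsq_lin_le _ _ _))//.
  by rewrite scalerBr opprD addrACA.
- exact: cvg_cst.
- have := @cvgr_lin _ (2 * (Re a ^+ 2 + Im a ^+ 2)) 2 _ _ _ _ uu vv.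
  by rewrite !mulr0 addr0.
Qed.

Lemma hcvgBl (u_ : nat -> V) u v : hcvg u_ u -> hcvg (fun n => v - u_ n) (v - u).
Proof.
rewrite /hcvg (_ : (fun n => nsq (_ - _ - _)) = fun n => nsq (u_ n - u))//.
by apply/funext => n; rewrite nsqBC opprB addrC subrKA.
Qed.

Lemma hcvg_heq (u_ : nat -> V) u v : hcvg u_ u -> heq u v -> hcvg u_ v.
Proof.
move=> + /heqE uv; rewrite /hcvg => uu.
apply: (@squeeze_cvgr _ _ _ _ (cst 0) (fun n => 2 * nsq (u_ n - u))).
- apply: nearW => n; rewrite nsq_ge0 /= (le_trans (nsq_tri _ u _))//.
  by rewrite uv mulr0 addr0.
- exact: cvg_cst.
- by rewrite -(mulr0 2); apply: cvgM => //; exact: cvg_cst.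
Qed.

Lemma hcvg_cauchy (u_ : nat -> V) u : hcvg u_ u -> hcauchy u_.
Proof.
move=> uu e e0; have e4 : 0 < e / 4 by rewrite divr_gt0.
have /cvgrPdist_lt/(_ _ e4)[N _ h] := uu.
exists N => m n Nm Nn; apply: le_lt_trans (nsq_tri _ u _) _.
have := h m Nm; have := h n Nn; rewrite /= !sub0r !normrN !ger0_norm ?nsq_ge0//.
by rewrite (nsqBC u); lra.
Qed.

Lemma polarization u v : hip u v =
  Complex ((nsq (u + v) - nsq u - nsq v) / 2)
          ((nsq (u + Complex 0 1 *: v) - nsq u - nsq v) / 2).
Proof.
rewrite !nsqD nsqZ hipZr; case: (hip u v) => x y /=.
by congr Complex; field.
Qed.

End SquaredNorm.

Definition hcomplete {R : realType} (V : hermSpace R) :=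
  forall u_ : nat -> V, hcauchy u_ -> exists u, hcvg u_ u.

(** * Closing an isometric relation with total range into a unitary map *)

Section UnitaryExtension.
Context {R : realType} {G : groupType} {V W : hermSpace R}.
Variables (rho : unitaryRep G V) (sigma : unitaryRep G W) (T : V -> W -> Prop).
Hypothesis Vcomplete : hcomplete V.
Hypothesis Wcomplete : hcomplete W.
Hypothesis T_lin : forall a u w u' w', T u w -> T u' w' ->
  T (a *: u + u') (a *: w + w').
Hypothesis T_nsq : forall u w, T u w -> nsq w = nsq u.
Hypothesis T_dense : forall u (e : R), 0 < e ->
  exists u' w', T u' w' /\ nsq (u' - u) < e.
Hypothesis T_total : forall z, (forall u w, T u w -> hip w z = 0) -> nsq z = 0.
Hypothesis T_rep : forall g u w, T u w -> T (rho g u) (sigma g w).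

(* The closure of the graph of [T] is the graph of the unitary. *)
Let Tbar u w := exists u_ w_,
  [/\ forall n, T (u_ n) (w_ n), hcvg u_ u & hcvg w_ w].

Let Tbar_lin a u w u' w' : Tbar u w -> Tbar u' w' ->
  Tbar (a *: u + u') (a *: w + w').
Proof.
move=> [u_ [w_ [T1 T2 T3]]] [u'_ [w'_ [T1' T2' T3']]].
exists (fun n => a *: u_ n + u'_ n), (fun n => a *: w_ n + w'_ n).
by split=> [n||]; [exact: T_lin|exact: hcvg_lin|exact: hcvg_lin].
Qed.

Let Tbar_nsq u w : Tbar u w -> nsq w = nsq u.
Proof.
move=> [u_ [w_ [T1 /hcvg_nsq T2 /hcvg_nsq T3]]].
apply: (cvg_unique (@Rhausdorff _) T3).
by rewrite (_ : (fun n => _) = fun n => nsq (u_ n))//; apply/funext => n; exact: T_nsq.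
Qed.

Let Tbar_heq u w w' : Tbar u w -> heq w w' -> Tbar u w'.
Proof.
move=> [u_ [w_ [T1 T2 T3]]] ww'; exists u_, w_; split => //.
exact: hcvg_heq ww'.
Qed.

Let T_sub u w u' w' : T u w -> T u' w' -> T (u - u') (w - w').
Proof.
by move=> h1 h2; have := T_lin (-1) h2 h1; rewrite !scaleN1r ![- _ + _]addrC.
Qed.

Let Tbar_sub u w u' w' : Tbar u w -> Tbar u' w' -> Tbar (u - u') (w - w').
Proof.
by move=> h1 h2; have := Tbar_lin (-1) h2 h1; rewrite !scaleN1r ![- _ + _]addrC.
Qed.

Let Tbar_inj u w w' : Tbar u w -> Tbar u w' -> heq w w'.
Proof.
move=> h1 h2; apply/heqE; rewrite (Tbar_nsq (Tbar_sub h1 h2)) subrr.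
exact: nsq0.
Qed.

Let T_cauchyl u_ w_ : (forall n, T (u_ n) (w_ n)) -> hcauchy u_ -> hcauchy w_.
Proof.
move=> Tuw cu e e0; have [N h] := cu e e0; exists N => m n Nm Nn.
by rewrite (T_nsq (T_sub (Tuw m) (Tuw n))); exact: h.
Qed.

Let T_cauchyr u_ w_ : (forall n, T (u_ n) (w_ n)) -> hcauchy w_ -> hcauchy u_.
Proof.
move=> Tuw cu e e0; have [N h] := cu e e0; exists N => m n Nm Nn.
by rewrite -(T_nsq (T_sub (Tuw m) (Tuw n))); exact: h.
Qed.

Let Tbar_ex u : exists w, Tbar u w.
Proof.
have /choice[f hf] : forall n : nat, exists uw : V * W, T uw.1 uw.2 /\ nsq (uw.1 - u) < n.+1%:R^-1.
  by move=> n; have [|u' [w' h]] := T_dense u (e := n.+1%:R^-1); [rewrite invr_gt0|exists (u', w')].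
have cu : hcvg (fst \o f) u.
  apply: (@squeeze_cvgr _ _ _ _ (cst 0) (fun n => n.+1%:R^-1)).
  - by apply: nearW => n; rewrite nsq_ge0 /= ltW//; have [] := hf n.
  - exact: cvg_cst.
  - exact: cvg_harmonic.
have fT n : T ((fst \o f) n) ((snd \o f) n) by have [] := hf n.
have [w cw] := Wcomplete (T_cauchyl fT (hcvg_cauchy cu)).
by exists w, (fst \o f), (snd \o f).
Qed.

(* [z] is approximated by a minimizing sequence of [nsq (z - w)] over the range
   of [T], Cauchy by the parallelogram law; its limit is the projection of [z]. *)
Let Tbar_surj z : exists u, Tbar u z.
Proof.
pose D : set R := [set x | exists u w, T u w /\ x = nsq (z - w)].
have T0 : T 0 0.
  by have [u [w [h _]]] := T_dense 0 ltr01; have := T_sub h h; rewrite !subrr.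
have D0 : D !=set0 by exists (nsq (z - 0)), 0, 0.
have Dlb : has_lbound D by exists 0 => _ [u [w [_ ->]]]; exact: nsq_ge0.
have hI : has_inf D by split.
pose d := inf D.
have dle u w : T u w -> d <= nsq (z - w).
  by move=> h; apply: ge_inf => //; exists u, w.
have /choice[f hf] : forall n : nat, exists uw : V * W,
    T uw.1 uw.2 /\ nsq (z - uw.2) < d + n.+1%:R^-1.
  move=> n; have n0 : 0 < n.+1%:R^-1 :> R by rewrite invr_gt0.
  by have [_ [u [w [h ->]]] hd] := inf_adherent n0 hI; exists (u, w).
pose u_ := fst \o f; pose w_ := snd \o f.
have fT n : T (u_ n) (w_ n) by have [] := hf n.
have fd n : nsq (z - w_ n) < d + n.+1%:R^-1 by have [] := hf n.
have parallelogram (x y : W) :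
    nsq (x - y) + nsq (x + y) = 2 * nsq x + 2 * nsq y.
  by rewrite !nsqD hipNr raddfN /= nsqN; ring.
have cw : hcauchy w_.
  move=> e e0; have e4 : 0 < e / 4 by rewrite divr_gt0.
  have /cvgrPdist_lt/(_ _ e4)[N _ hN] := @cvg_harmonic R.
  exists N => m n Nm Nn.
  have := parallelogram (z - w_ n) (z - w_ m).
  have -> : z - w_ n - (z - w_ m) = w_ m - w_ n by rewrite opprB addrC subrKA.
  have -> : z - w_ n + (z - w_ m) = 2%:C%C *: (z - (2^-1)%:C%C *: (w_ n + w_ m)).
    rewrite scalerBr scalerA -rmorphM /= divff ?pnatr_eq0// scale1r.
    by rewrite rmorphD /= scalerDl scale1r addrACA opprD.
  rewrite nsqZ /= expr0n /= addr0.
  have T2 : T ((2^-1)%:C%C *: (u_ n + u_ m)) ((2^-1)%:C%C *: (w_ n + w_ m)).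
    rewrite !scalerDr; apply: T_lin => //.
    by have := T_lin (2^-1)%:C%C (fT m) T0; rewrite !addr0.
  have := dle _ _ T2; have := fd n; have := fd m.
  have := hN m Nm; have := hN n Nn.
  rewrite /= !sub0r !normrN !ger0_norm ?invr_ge0//.
  move: (nsq _) (nsq _) (nsq _) (nsq _) (m.+1%:R^-1) (n.+1%:R^-1) => *; lra.
have [w ww] := Wcomplete cw.
have [u uu] := Vcomplete (T_cauchyr fT cw).
have Tuw : Tbar u w by exists u_, w_.
exists u; apply: (Tbar_heq Tuw).
have dz : nsq (z - w) <= d.
  have h1 := hcvgBl z ww.
  have h2 : (fun n : nat => d + n.+1%:R^-1 : R) @ \oo --> d + 0.
    by apply: cvgD; [exact: cvg_cst|exact: cvg_harmonic].
  rewrite -[leRHS]addr0; apply: (ler_cvg_to (hcvg_nsq h1) h2).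
  by apply: nearW => n; exact/ltW.
have dle' u' w' : Tbar u' w' -> d <= nsq (z - w').
  move=> [u'_ [w'_ [T1 T2 T3]]].
  have h1 := hcvgBl z T3.
  apply: (ler_cvg_to (cvg_cst d) (hcvg_nsq h1)).
  by apply: nearW => n; exact: dle.
have Treal u' w' : T u' w' -> Re (hip w' (z - w)) = 0.
  move=> h; have Tb' : Tbar u' w'.
    by exists (fun=> u'), (fun=> w'); split => //; rewrite /hcvg subrr nsq0; exact: cvg_cst.
  have q (t : R) : 0 <= t ^+ 2 * nsq w' + 2 * t * Re (hip w' (z - w)).
    have := dle' _ _ (Tbar_lin (- t)%:C%C Tb' Tuw).
    rewrite opprD addrCA -scaleNr -rmorphN /= opprK nsqD nsqZ Re_hipZl /=.
    by rewrite expr0n /= addr0; lra.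
  have [w0|w0] := eqVneq (nsq w') 0.
    by have := q (- Re (hip w' (z - w))); rewrite w0; nra.
  have w1 : 0 < nsq w' by rewrite lt0r w0 nsq_ge0.
  set r := Re _ in q *; have := q (- r / nsq w').
  rewrite (_ : _ + _ = - (r ^+ 2 / nsq w')); last by field.
  rewrite oppr_ge0 pmulr_lle0 ?invr_gt0// => r0.
  by apply/eqP; rewrite -sqrf_eq0 eq_le r0 sqr_ge0.
have Torth u' w' : T u' w' -> hip w' (z - w) = 0.
  move=> h; have := Treal _ _ h.
  have := Treal _ _ (T_lin (Complex 0 1) h T0).
  rewrite !addr0 hipZl; case: (hip _ _) => x y /=.
  by rewrite mul0r mul1r sub0r => /eqP; rewrite oppr_eq0 => /eqP -> ->.
by apply/heqE; rewrite nsqBC; exact: T_total.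
Qed.

Let Tbar_rep g u w : Tbar u w -> Tbar (rho g u) (sigma g w).
Proof.
have S (H : hermSpace R) (s : unitaryRep G H) x y :
    nsq (s g x - s g y) = nsq (x - y).
  have := heq_nsq (ract_linear s g (-1) y x).
  rewrite !scaleN1r ![- _ + _]addrC => <-.
  by rewrite /nsq ract_isometry.
move=> [u_ [w_ [T1 T2 T3]]]; exists (fun n => rho g (u_ n)), (fun n => sigma g (w_ n)).
split=> [n||]; first exact: T_rep.
- by rewrite /hcvg; under eq_fun do rewrite S.
- by rewrite /hcvg; under eq_fun do rewrite S.
Qed.

Lemma unitary_extension : unitarily_equivalent rho sigma.
Proof.
have [U TU] := choice Tbar_ex.
exists U; last by move=> g u; exact: (Tbar_inj (TU _) (Tbar_rep g (TU u))).
split.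
- by move=> a u v; apply: (Tbar_inj (TU _)); exact: Tbar_lin.
- move=> u v; rewrite !polarization (Tbar_nsq (TU u)) (Tbar_nsq (TU v)).
  have h1 := Tbar_lin 1 (TU u) (TU v); rewrite !scale1r in h1.
  have h2 := Tbar_lin (Complex 0 1) (TU v) (TU u).
  by rewrite (Tbar_nsq h1) ![_ + Complex 0 1 *: _]addrC (Tbar_nsq h2).
- by move=> w; have [u h] := Tbar_surj w; exists u; exact: Tbar_inj h.
Qed.
End UnitaryExtension.

(** * Completeness of L^2 *)

Lemma cvg_geometric_increments {R : realType} (s : nat -> R) (C : R) :
  (forall j, (2 ^+ j * (s j.+1 - s j)) ^+ 2 <= C) -> cvgn s.
Proof.
move=> hC; have C0 : 0 <= C by apply: le_trans (hC 0%N); exact: sqr_ge0.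
have hs j : `|s j.+1 - s j| <= (1 + C) * 2^-1 ^+ j.
  rewrite exprVn ler_pdivlMr ?exprn_gt0// mulrC.
  rewrite -[2 ^+ j]gtr0_norm ?exprn_gt0// -normrM.
  have := hC j; rewrite -real_normK ?num_real//.
  have := normr_ge0 (2 ^+ j * (s j.+1 - s j)); move: `|_| => y; nra.
have : cvgn (series (telescope s)).
  apply: normed_cvg; apply: (series_le_cvg (v_ := geometric (1 + C) 2^-1)) => //.
  - by move=> n; exact: normr_ge0.
  - by move=> n; rewrite /geometric /= mulr_ge0 ?addr_ge0// exprn_ge0// invr_ge0.
  - apply: is_cvg_geometric_series; rewrite ger0_norm ?invr_ge0//.
    by rewrite invf_lt1// ltr1n.
rewrite telescopeK => sl; rewrite (_ : s = (fun n => s n - s 0%N) + cst (s 0%N)).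
  by apply: is_cvgD => //; exact: is_cvg_cst.
by apply/funext => n; rewrite [RHS]subrK.
Qed.

Lemma cvgrD0 {R : realType} (x y : nat -> R) : x @ \oo --> (0 : R) ->
  y @ \oo --> (0 : R) -> (fun n => x n + y n) @ \oo --> (0 : R).
Proof. by move=> x0 y0; have := cvgr_lin (a := 1) (b := 1) x0 y0;
  under eq_fun do rewrite !mul1r; rewrite !mulr0 addr0. Qed.

Lemma cvgr_sum0 {R : realType} (I : Type) (r : seq I) (x : I -> nat -> R) :
  (forall i, x i @ \oo --> (0 : R)) ->
  (fun n => \sum_(i <- r) x i n) @ \oo --> (0 : R).
Proof.
move=> x0; elim: r => [|i r IH].
  by under eq_fun do rewrite big_nil; exact: cvg_cst.
under eq_fun do rewrite big_cons.
exact: cvgrD0.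
Qed.

Section FiniteDimensional.
Context {R : realType} {V : finHermSpace R}.
Implicit Types (u v : V).

Lemma nsq_coord u :
  nsq u = \sum_i (Re (hip u (hbasis i)) ^+ 2 + Im (hip u (hbasis i)) ^+ 2).
Proof.
rewrite /nsq hip_basis raddf_sum; apply: eq_bigr => i _.
by case: (hip _ _) => x y /=; ring.
Qed.

Lemma hip_comb (c : 'I_(hdim V) -> R[i]) i :
  hip (\sum_j c j *: hbasis j) (hbasis i) = c i.
Proof.
rewrite hip_suml (bigD1 i)//= hipZl hbasis_ortho eqxx mulr1 big1 ?addr0// => j ji.
by rewrite hipZl hbasis_ortho (negbTE ji) mulr0.
Qed.

Lemma hcvg_geometric_increments (v_ : nat -> V) (M : R) :
  (forall j, 4 ^+ j * nsq (v_ j.+1 - v_ j) <= M) -> exists l, hcvg v_ l.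
Proof.
move=> hM.
have bd b (s := fun j => Re (hip (v_ j) b)) : cvgn s.
  apply: (@cvg_geometric_increments _ _ (M * nsq b)) => j.
  rewrite exprMn /s -raddfB /= -hipNl -hipDl -exprM mulnC exprM -natrX.
  apply: (@le_trans _ _ (4 ^+ j * (nsq (v_ j.+1 - v_ j) * nsq b))).
    by rewrite ler_wpM2l ?exprn_ge0 ?hip_cauchy_schwarz.
  by rewrite mulrA ler_wpM2r ?nsq_ge0.
have bdI i : cvgn (fun j => Im (hip (v_ j) (hbasis i))).
  rewrite (_ : (fun _ => _) = fun j => Re (hip (v_ j) (Complex 0 1 *: hbasis i))).
    exact: bd.
  by apply/funext => j; exact: Im_hipE.
pose lre i := limn (fun j => Re (hip (v_ j) (hbasis i))).
pose lim i := limn (fun j => Im (hip (v_ j) (hbasis i))).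
exists (\sum_i Complex (lre i) (lim i) *: hbasis i).
rewrite /hcvg; under eq_fun do rewrite nsq_coord.
apply: cvgr_sum0 => i.
have sq0 (x : nat -> R) (c : R) : x @ \oo --> c -> (x n - c) ^+ 2 @[n --> \oo] --> 0.
  move=> /subr_cvg0 xc; have h : (x n - c) ^+ 2 @[n --> \oo] --> (0 : R) ^+ 2.
    by rewrite expr2; under eq_fun do rewrite expr2; exact: cvgM.
  by rewrite expr0n in h.
apply: cvgrD0; under eq_fun do rewrite hipDl hipNl hip_comb raddfB /=.
  by apply: sq0; exact: bd.
by apply: sq0; exact: bdI.
Qed.
End FiniteDimensional.

Section L2Complete.
Context {R : realType} {d} {X : measurableType d}
  {mu : {measure set X -> \bar R}} {D : set X} {mD : measurable D}
  {V : finHermSpace R}.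
Implicit Types (u v : L2 mu mD V).

Lemma measurable_nsq (f : X -> V) : measurable_section D f ->
  measurable_fun D (fun x => nsq (f x)).
Proof. by move=> mf; have [] := cmeasurable_hip mf mf. Qed.

Lemma nsq_L2 u : (nsq u)%:E = (\int[mu]_(x in D) (nsq (u x))%:E)%E.
Proof.
have [_ su] := L2_mem u.
rewrite (_ : nsq u = \int[mu]_(x in D) nsq (u x))// /Rintegral fineK//.
exact: integrable_fin_num su.
Qed.

Lemma fatou_nsq (E : set X) (f_ : nat -> X -> V) (f : X -> V) (C : \bar R) :
  measurable E -> E `<=` D -> (forall n, measurable_section D (f_ n)) ->
  (forall x, E x -> hcvg (f_^~ x) (f x)) ->
  (forall n, (\int[mu]_(x in D) (nsq (f_ n x))%:E <= C)%E) ->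
  (\int[mu]_(x in E) (nsq (f x))%:E <= C)%E.
Proof.
move=> mE ED mf cf leC.
have mf' n : measurable_fun D (fun x => (nsq (f_ n x))%:E).
  exact/measurable_EFinP/measurable_nsq.
have mfE n : measurable_fun E (fun x => (nsq (f_ n x))%:E).
  exact: measurable_funS (mf' n).
rewrite (eq_integral (fun x => limn_einf (fun n => (nsq (f_ n x))%:E))); last first.
  move=> x /set_mem Ex.
  have /cvg_limn_einf_sup[-> _]// : (nsq (f_ n x))%:E @[n --> \oo] --> (nsq (f x))%:E.
  by apply: cvg_EFin; [exact: nearW|exact: (hcvg_nsq (cf _ Ex))].
apply: (le_trans (fatou _ mE mfE _)); first by move=> n x _; rewrite lee_fin nsq_ge0.
rewrite limn_einf_lim; apply: lime_le; first exact: is_cvg_einfs.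
apply: nearW => n; apply: (@le_trans _ _ (\int[mu]_(x in E) (nsq (f_ n x))%:E)%E).
  apply: ge_ereal_inf; exists (\int[mu]_(x in E) (nsq (f_ n x))%:E)%E => //.
  by exists n => /=.
apply: le_trans (leC n); apply: ge0_subset_integral => //.
by move=> x _; rewrite lee_fin nsq_ge0.
Qed.

(* Along a subsequence with [nsq (v j.+1 - v j) < 8^-j] the weighted sum [w] of
   the [4^j nsq (v j.+1 x - v j x)] is integrable, hence the subsequence converges
   at every [x] with [w x] finite; Fatou's lemma gives convergence in L^2. *)
Lemma L2_complete : hcomplete (L2 mu mD V).
Proof.
move=> u_ cu.
have /choice[N hN] (j : nat) : exists N, forall m n, (N <= m)%N -> (N <= n)%N ->
    nsq (u_ m - u_ n) < 8^-1 ^+ j.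
  by apply: cu; rewrite exprn_gt0// invr_gt0.
pose k j := (j + \sum_(i < j.+1) N i)%N.
have Nk j : (N j <= k j)%N by rewrite /k big_ord_recr/= addnA leq_addl.
have kS j : (k j <= k j.+1)%N by rewrite leq_add// [leqRHS]big_ord_recr/= leq_addr.
pose v j := u_ (k j).
have dv j : nsq (v j.+1 - v j) < 8^-1 ^+ j.
  by apply: hN => //; exact: leq_trans (kS j).
pose F j x := (4 ^+ j * nsq (v j.+1 x - v j x))%:E.
have mv j : measurable_section D (v j) by have [] := L2_mem (v j).
have md j : measurable_section D (fun x => v j.+1 x - v j x).
  by have [] := L2_mem (v j.+1 - v j : L2_sort mu mD V).
have mF j : measurable_fun D (F j).
  by apply/measurable_EFinP; apply: measurable_funM => //; exact: measurable_nsq.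
have F0 j x : D x -> (0 <= F j x)%E.
  by move=> _; rewrite lee_fin mulr_ge0 ?nsq_ge0// exprn_ge0.
pose w x := (\sum_(j <oo) F j x)%E.
have mw : measurable_fun D w by apply: ge0_emeasurable_sum => // j x Dx _; exact: F0.
have w0 x : D x -> (0 <= w x)%E by move=> Dx; apply: nneseries_ge0 => j _ _; exact: F0.
have iF j : (\int[mu]_(x in D) F j x <= (2^-1 ^+ j)%:E)%E.
  rewrite /F; under eq_integral do rewrite EFinM.
  rewrite ge0_integralZl_EFin//; last 2 first.
  - by move=> x _; rewrite lee_fin nsq_ge0.
  - by apply/measurable_EFinP; exact: measurable_nsq.
  rewrite -[X in (_ * X)%E]/(\int[mu]_(x in D) (nsq ((v j.+1 - v j : L2_sort mu mD V) x))%:E)%E.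
  rewrite -nsq_L2 -EFinM lee_fin; apply: le_trans (ler_wpM2l _ (ltW (dv j))) _.
    by rewrite exprn_ge0.
  by rewrite -exprMn (_ : 4 * 8^-1 = 2^-1 :> R)//; field.
have iw : (\int[mu]_(x in D) w x < +oo)%E.
  rewrite integral_nneseries//; apply: (@le_lt_trans _ _ 2%:E); last by rewrite ltry.
  apply: lime_le; first by apply: is_cvg_nneseries => j _ _; apply: integral_ge0 => x; exact: F0.
  apply: nearW => n; apply: (@le_trans _ _ (\sum_(0 <= j < n) (2^-1 ^+ j)%:E)%E).
    by apply: lee_sum => j _; exact: iF.
  rewrite sumEFin lee_fin; apply: (@le_trans _ _ (2 - 2 * 2^-1 ^+ n)).
    elim: n => [|n IH]; first by rewrite big_geq// expr0; lra.
    by rewrite big_nat_recr//= (le_trans (lerD IH (lexx _)))// exprS; lra.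
  by rewrite gerBl mulr_ge0// exprn_ge0// invr_ge0.
have wint : mu.-integrable D w.
  apply/integrableP; split => //.
  by under eq_integral => x /set_mem Dx do rewrite gee0_abs ?w0//.
pose E := D `&` [set x | (w x < +oo)%E].
have mE : measurable E by exact: emeasurable_fun_infty_o.
have ED : E `<=` D by exact: subIsetl.
have muE : mu (D `\` E) = 0%E.
  apply: measure_negligible; first exact: measurableD.
  apply: negligibleS (integrable_ae mD wint) => x [Dx nEx] /(_ Dx) wx.
  by apply: nEx; split => //=; rewrite ltey_eq wx.
have /choice[l hl] x : exists l : V, (E x -> hcvg (fun j => v j x) l) /\ (~ E x -> l = 0).
  have [Ex|nEx] := pselect (E x); last by exists 0.
  have [j|l vl] := @hcvg_geometric_increments _ _ (fun j => v j x) (fine (w x)); last by exists l.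
  rewrite -lee_fin fineK; last by rewrite ge0_fin_numE ?w0 ?(ED _ Ex)//; case: Ex.
  rewrite -/(F j x); apply: le_trans (nneseries_lim_ge j.+1 _); last first.
    by move=> i _ _; exact: F0 (ED _ Ex).
  rewrite big_nat_recr//= leeDr// sume_ge0// => i _; exact: F0 (ED _ Ex).
have mRe b : measurable_fun D (fun x => Re (hip (l x) b)).
  apply: (measurable_fun_cvg (h := fun j x => \1_E x * Re (hip (v j x) b))) => [j|x Dx].
    by apply: measurable_funM; [exact: measurable_indic|have [] := mv j b].
  have [h1 h2] := hl x; have [Ex|nEx] := pselect (E x).
    rewrite indicE mem_set//; under eq_fun do rewrite mul1r.
    apply/subr_cvg0; have := hcvg_Re_hip b (h1 Ex).
    by under eq_fun do rewrite hipDl hipNl raddfB /=.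
  rewrite indicE memNset// (h2 nEx) hip0l; under eq_fun do rewrite mul0r.
  exact: cvg_cst.
have ml : measurable_section D l.
  by move=> b; split; [exact: mRe|under eq_fun do rewrite Im_hipE; exact: mRe].
have mul n : measurable_section D (fun x => u_ n x - l x).
  have [mu_ _] := L2_mem (u_ n).
  by have := measurable_section_lin (-1) ml mu_; under eq_fun do rewrite scaleN1r addrC.
have DE : D `\` (D `\` E) = E by rewrite setDD setIC; apply/setIidl.
have key (e : R) : 0 < e -> exists M, forall n, (M <= n)%N ->
    (\int[mu]_(x in D) (nsq (u_ n x - l x))%:E <= e%:E)%E.
  move=> e0; have [M hM] := cu e e0; exists M => n Mn.
  rewrite (@ge0_negligible_integral _ _ _ _ D (D `\` E))//; last 3 first.
  - exact: measurableD.
  - by apply/measurable_EFinP; exact: measurable_nsq.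
  - by move=> x _; rewrite lee_fin nsq_ge0.
  rewrite DE; apply: (@fatou_nsq E (fun j x => u_ n x - v (j + M)%N x)) => //.
  - move=> j; by have [] := L2_mem (u_ n - v (j + M)%N : L2_sort mu mD V).
  - move=> x Ex; apply: hcvgBl; have [h1 _] := hl x.
    by have := h1 Ex; rewrite /hcvg -(cvg_shiftn M).
  - move=> j; rewrite -[X in (X <= _)%E]/(\int[mu]_(x in D)
      (nsq ((u_ n - v (j + M)%N : L2_sort mu mD V) x))%:E)%E.
    rewrite -nsq_L2 lee_fin ltW// hM// /k.
    by rewrite (leq_trans (leq_addl j M))// leq_addr.
have sl : square_integrable mu D l.
  have [M /(_ M (leqnn _)) hM] := key 1 ltr01.
  have [mu_ su_] := L2_mem (u_ M).
  have sul : square_integrable mu D (fun x => u_ M x - l x).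
    apply/integrableP; split; first by apply/measurable_EFinP; exact: measurable_nsq.
    under eq_integral do rewrite gee0_abs ?lee_fin ?Re_hip_ge0//.
    by apply: le_lt_trans hM _; rewrite ltry.
  have := square_integrable_lin mD (-1) (mul M) sul mu_ su_.
  by rewrite (_ : (fun _ => _) = l)//; apply/funext => x; rewrite scaleN1r opprB subrK.
have Ll : l \in L2_pred mu (V := V) mD by exact/asboolP.
exists (L2Fun Ll : L2 mu mD V); apply/cvgrPdist_le => e e0.
have [M hM] := key e e0; exists M => // n /hM.
rewrite /= sub0r normrN ger0_norm ?nsq_ge0// -lee_fin nsq_L2.
exact.
Qed.
End L2Complete.

(** * Uniqueness of Fourier coefficients on the square *)

Lemma integral_preimage_eq0 {R : realType} {d d'} {X : measurableType d}
    {Y : measurableType d'} (mu : {measure set X -> \bar R}) (D : set X)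
    (f : X -> \bar R) (h : X -> Y) (G : set (set Y)) :
  measurable D -> mu.-integrable D f -> measurable_fun [set: X] h ->
  measurable = <<s G >> -> setI_closed G ->
  (\int[mu]_(x in D) f x = 0)%E ->
  (forall B, G B -> \int[mu]_(x in D `&` h @^-1` B) f x = 0)%E ->
  (forall B, measurable B -> \int[mu]_(x in D `&` h @^-1` B) f x = 0)%E.
Proof.
move=> mD fi mh GE GI D0 GP B.
have mDh C : measurable C -> measurable (D `&` h @^-1` C).
  by move=> mC; apply: measurableI => //; rewrite -[h @^-1` _]setTI; exact: mh.
rewrite GE; apply: (dynkin_induction (P := fun B =>
    (\int[mu]_(x in D `&` h @^-1` B) f x = 0)%E)) GE GI _ GP _ _ B.
- by rewrite preimage_setT setIT.
- move=> S mS S0; move: D0; rewrite -{1}(setIT D) -(setUv (h @^-1` S)) setIUr.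
  rewrite integral_setU//=; last 4 first.
  - exact: mDh.
  - by rewrite preimage_setC; apply: mDh; exact: measurableC.
  - rewrite -setIUr setUv setIT; exact: measurable_int fi.
  - by apply/disj_setPS => x /= [[_ hS] [_ /(_ hS)]].
  by rewrite S0 add0e -preimage_setC.
- move=> F mF tF F0; rewrite preimage_bigcup setI_bigcupr integral_bigcup//.
  + by rewrite eseries0.
  + apply/trivIsetP => i j _ _ ij; rewrite setIACA -(preimage_setI h).
    by move/trivIsetP : tF => /(_ i j I I ij) ->; rewrite preimage_set0 setI0.
  + by move=> k; exact: mDh.
  + apply: integrableS fi => //; last by move=> x [k _ []].
    by apply: bigcupT_measurable => k; exact: mDh.
Qed.

Section SquareVanishing.
Context {R : realType}.
Local Notation leb := (@lebesgue_measure R).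
Local Notation leb2 := (leb \x leb)%E.
Local Notation sq := (@square01 R).

Lemma square_integral_eq0 (f : measurableTypeR R * measurableTypeR R -> \bar R) :
  leb2.-integrable sq f ->
  (forall A, measurable A ->
     \int[leb2]_(z in sq `&` fst @^-1` A) f z = 0)%E ->
  (forall A (b : R), measurable A ->
     \int[leb2]_(z in (sq `&` fst @^-1` A) `&` snd @^-1` `]-oo, b[) f z = 0)%E ->
  {ae leb2, forall z, sq z -> f z = 0%E}.
Proof.
move=> fi A0 Ab0; have msq := @measurable_square01 R.
have mAsq A : measurable A -> measurable (sq `&` fst @^-1` A).
  by move=> mA; apply: measurableI => //; rewrite -[_ @^-1` _]setTI; exact: measurable_fst.
have AB0 A B : measurable A -> measurable B ->
    (\int[leb2]_(z in (sq `&` fst @^-1` A) `&` snd @^-1` B) f z = 0)%E.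
  move=> mA; apply: (@integral_preimage_eq0 _ _ _ _ (measurableTypeR R) _ _ _ _
      (@RGenInftyO.G R)) => //.
  - exact: mAsq.
  - by apply: integrableS fi => //; exact: mAsq.
  - exact: RGenInftyO.measurableE.
  - move=> _ _ [x ->] [y ->]; exists (Num.min x y).
    by apply/seteqP; split=> z /=; rewrite !in_itv /= lt_min => /andP.
  - exact: A0.
  - by move=> _ [b ->]; exact: Ab0.
have E0 E : measurable E -> (\int[leb2]_(z in sq `&` id @^-1` E) f z = 0)%E.
  apply: (integral_preimage_eq0 _ _ _ (@measurable_prod_measurableType _ _ _ _)) => //.
  - move=> _ _ [A1 mA1 [A2 mA2 <-]] [B1 mB1 [B2 mB2 <-]].
    exists (A1 `&` B1); first exact: measurableI.
    by exists (A2 `&` B2); [exact: measurableI|rewrite setXI].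
  - by have := A0 setT measurableT; rewrite preimage_setT setIT.
  - move=> _ [A mA [B mB <-]]; rewrite preimage_id -[RHS](AB0 A B)//.
    by rewrite -setIA.
apply: integral_ae_eq => // E Esq mE; rewrite integral0.
by rewrite -(setIidr Esq); exact: E0.
Qed.
End SquareVanishing.

Lemma bernoulli_le {R : realFieldType} (y : R) m : 0 <= y <= 1 ->
  1 - m%:R * y <= (1 - y) ^+ m.
Proof.
move=> /andP[y0 y1]; elim: m => [|m IH]; first by rewrite mul0r subr0 expr0.
rewrite exprS; apply: (@le_trans _ _ ((1 - y) * (1 - m%:R * y))); last first.
  by rewrite ler_wpM2l// subr_ge0.
rewrite -natr1 -subr_ge0 (_ : _ - _ = m%:R * y ^+ 2); last by ring.
by rewrite mulr_ge0// sqr_ge0.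
Qed.

Lemma bernoulli_mul_le {R : realFieldType} (y : R) m : 0 <= y <= 1 ->
  (1 - y) ^+ m * (m%:R * y) <= 1.
Proof.
move=> /andP[y0 y1]; have p0 : 0 <= (1 - y) ^+ m by rewrite exprn_ge0// subr_ge0.
apply: (@le_trans _ _ ((1 - y) ^+ m * (1 + y) ^+ m)).
  apply: ler_wpM2l => //; elim: m {p0} => [|m IH]; first by rewrite mul0r.
  have h : 1 <= (1 + y) ^+ m by rewrite exprn_ege1// lerDl.
  by rewrite exprS -natr1; nra.
rewrite -exprMn exprn_ile1//; first by nra.
by have := sqr_ge0 y; rewrite expr2; lra.
Qed.

(* The Brosowski-Deutsch approximation of an indicator, by Bernoulli's inequality. *)
Lemma indicator_approx {R : realType} (w : R) : 0 <= w <= 1 -> w != 2^-1 ->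
  (1 - w ^+ n) ^+ (2 ^ n) @[n --> \oo] --> ((w < 2^-1)%R%:R : R).
Proof.
move=> /andP[w0 w1] w2.
have wn n : 0 <= w ^+ n <= 1 by rewrite exprn_ge0// exprn_ile1.
have p0 n : 0 <= (1 - w ^+ n) ^+ (2 ^ n).
  by rewrite exprn_ge0// subr_ge0; have /andP[] := wn n.
have E n : (2 ^ n)%:R * w ^+ n = (2 * w) ^+ n by rewrite natrX -exprMn.
have [lt|ge] := ltP w 2^-1.
- apply: (@squeeze_cvgr _ _ _ _ (fun n => 1 - (2 * w) ^+ n) (cst 1)).
  + apply: nearW => n; rewrite -E bernoulli_le//= exprn_ile1//.
      by rewrite subr_ge0; have /andP[] := wn n.
    by rewrite gerBl; have /andP[] := wn n.
  + have h : (2 * w) ^+ n @[n --> \oo] --> (0 : R).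
      by apply: cvg_expr; rewrite ger0_norm; lra.
    by have := cvgB (cvg_cst (1 : R)) h; rewrite subr0; apply.
  + exact: cvg_cst.
- have gt : 2^-1 < w by rewrite lt_neqAle eq_sym w2.
  have w20 : 0 < 2 * w by lra.
  apply: (@squeeze_cvgr _ _ _ _ (cst 0) (fun n => ((2 * w)^-1) ^+ n)).
  + apply: nearW => n; rewrite p0/= exprVn.
    by rewrite -[leRHS]div1r ler_pdivlMr ?exprn_gt0// -E bernoulli_mul_le.
  + exact: cvg_cst.
  + apply: cvg_expr; rewrite ger0_norm ?invr_ge0 ?(ltW w20)//.
    by rewrite invf_lt1//; lra.
Qed.

Section ComplexIntegral.
Context {R : realType} {d} {X : measurableType d}
  (mu : {measure set X -> \bar R}) (D : set X) (mD : measurable D).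
Implicit Types f g : X -> R[i].

Definition cintegrable f := mu.-integrable D (fun x => (Re (f x))%:E) /\
  mu.-integrable D (fun x => (Im (f x))%:E).

Lemma cintegrable_measurable f : cintegrable f -> cmeasurable_fun D f.
Proof. by move=> [/measurable_int/measurable_EFinP h /measurable_int/measurable_EFinP]. Qed.

Lemma cintegrable_lin (a : R[i]) f g : cintegrable f -> cintegrable g ->
  cintegrable (fun x => a * f x + g x) /\
  cintegral mu D (fun x => a * f x + g x) = a * cintegral mu D f + cintegral mu D g.
Proof.
move=> [f1 f2] [g1 g2]; case: a => a b.
have hZ (k : R) (F : X -> R) : mu.-integrable D (fun x => (F x)%:E) ->
    mu.-integrable D (fun x => (k * F x)%:E).
  move=> /(integrableZl mD k) h; rewrite (_ : (fun _ => _) = (fun x => k%:E * (F x)%:E)%E)//.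
have hD (F G : X -> R) : mu.-integrable D (fun x => (F x)%:E) ->
    mu.-integrable D (fun x => (G x)%:E) -> mu.-integrable D (fun x => (F x + G x)%:E).
  by move=> h1 h2; have := integrableD mD h1 h2.
have hB (F G : X -> R) : mu.-integrable D (fun x => (F x)%:E) ->
    mu.-integrable D (fun x => (G x)%:E) -> mu.-integrable D (fun x => (F x - G x)%:E).
  by move=> h1 h2; have := integrableB mD h1 h2.
have r x : Re (Complex a b * f x + g x) = a * Re (f x) - b * Im (f x) + Re (g x).
  by case: (f x) (g x) => [? ?] [].
have i x : Im (Complex a b * f x + g x) = a * Im (f x) + b * Re (f x) + Im (g x).
  by case: (f x) (g x) => [? ?] [].
split; first split.
- by under eq_fun do rewrite r; apply: hD => //; apply: hB; exact: hZ.
- by under eq_fun do rewrite i; apply: (hD) => //; apply: (hD); exact: hZ.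
rewrite /cintegral; under eq_Rintegral do rewrite r.
rewrite RintegralD//; last by apply: hB; exact: hZ.
rewrite RintegralB//; [|exact: hZ..].
under [X in Complex _ X]eq_Rintegral do rewrite i.
rewrite [X in Complex _ X]RintegralD//; last by apply: hD; exact: hZ.
rewrite [X in Complex _ (X + _)]RintegralD//; [|exact: hZ..].
by rewrite !RintegralZl.
Qed.

Lemma cintegrable0 : cintegrable (fun=> 0) /\ cintegral mu D (fun=> 0) = 0.
Proof.
split; first by split; exact: integrable0.
by rewrite /cintegral /= /Rintegral integral0.
Qed.

Lemma cintegral_comb (I : Type) (r : seq I) (a : I -> R[i]) (F : I -> X -> R[i]) :
  (forall i, cintegrable (F i)) ->
  cintegrable (fun x => \sum_(i <- r) a i * F i x) /\
  cintegral mu D (fun x => \sum_(i <- r) a i * F i x) =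
  \sum_(i <- r) a i * cintegral mu D (F i).
Proof.
move=> iF; elim: r => [|i r [IH1 IH2]].
  by under eq_fun do rewrite big_nil; rewrite big_nil; exact: cintegrable0.
under eq_fun do rewrite big_cons; rewrite big_cons -IH2.
exact: cintegrable_lin.
Qed.

Lemma cintegral_ae f g : cmeasurable_fun D f -> cmeasurable_fun D g ->
  {ae mu, forall x, D x -> f x = g x} -> cintegral mu D f = cintegral mu D g.
Proof.
move=> [f1 f2] [g1 g2] fg; rewrite /cintegral /Rintegral; congr Complex; congr fine.
- apply: ae_eq_integral => //; do ?exact/measurable_EFinP.
  by apply: filterS fg => x /[apply] ->.
- apply: ae_eq_integral => //; do ?exact/measurable_EFinP.
  by apply: filterS fg => x /[apply] ->.
Qed.

Lemma cintegrableM_bounded (phi f : X -> R[i]) : cmeasurable_fun D phi ->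
  (forall x, D x -> `|Re (phi x)| <= 1 /\ `|Im (phi x)| <= 1) -> cintegrable f ->
  cintegrable (fun x => phi x * f x).
Proof.
move=> mphi phi1 fi; have [m1 m2] := cmeasurableM mphi (cintegrable_measurable fi).
case: fi => f1 f2; have f12 := integrableD mD (integrable_abse f1) (integrable_abse f2).
have key (p q a b : R) : `|p| <= 1 -> `|q| <= 1 -> `|p * a + q * b| <= `|a| + `|b|.
  move=> p1 q1; rewrite (le_trans (ler_normD _ _))// !normrM.
  by rewrite lerD// ler_piMl.
split; apply: (le_integrable mD _ _ f12); try exact/measurable_EFinP.
- move=> x /phi1[h1 h2]; rewrite /= lee_fin [leRHS]ger0_norm ?addr_ge0//.
  case: (phi x) (f x) h1 h2 => [p q] [a b] /= h1 h2.
  by rewrite -mulNr; apply: key; rewrite ?normrN.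
- move=> x /phi1[h1 h2]; rewrite /= lee_fin [leRHS]ger0_norm ?addr_ge0//.
  case: (phi x) (f x) h1 h2 => [p q] [a b] /= h1 h2.
  by rewrite [`|a| + _]addrC; exact: key.
Qed.
End ComplexIntegral.

Section ExpiPowers.
Context {R : realType}.
Implicit Types x y : R.

Lemma expiX x n : expi x ^+ n = expi (n%:R * x).
Proof.
elim: n => [|n IH]; first by rewrite mul0r expi0.
by rewrite exprS IH -expiD -natr1 mulrDl mul1r addrC.
Qed.

Lemma expiNr x : expi (- x) * expi x = 1.
Proof. by rewrite -expiD addNr expi0. Qed.

Lemma expi_neq0 x : expi x != 0.
Proof.
by apply/eqP => x0; have := expiNr x; rewrite x0 mulr0 => /esym/eqP; rewrite oner_eq0.
Qed.

Lemma conj_expi x : (expi x)^*%C = expi (- x).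
Proof. by rewrite /expi cosN sinN. Qed.

Lemma expi_le1 x : `|Re (expi x)| <= 1 /\ `|Im (expi x)| <= 1.
Proof.
rewrite /= !ler_norml cos_geN1 cos_le1 sin_geN1 sin_le1.
by [].
Qed.

Lemma expi_periodic x y (m : int) : x - y = 2 * pi * m%:~R -> expi x = expi y.
Proof. by move=> h; rewrite -(subrK y x) h expiD expi2pi mul1r. Qed.
End ExpiPowers.

Section FourierUniqueness.
Context {R : realType}.
Local Notation leb := (@lebesgue_measure R).
Local Notation leb2 := (leb \x leb)%E.
Local Notation sq := (@square01 R).
Local Notation X := (measurableTypeR R * measurableTypeR R)%type.
Implicit Types (x b c : R) (n : nat).

(* [bump c] lies in [0, 1] and is below 1/2 exactly on ]0, c[, for 0 < c <= 1
   and an argument in ]0, 1[ other than c. *)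
Let bump c x := (1 - sin (pi * x) * sin (pi * (c - x))) / 2.

Let bump01 c x : 0 <= bump c x <= 1.
Proof.
have h : `|sin (pi * x) * sin (pi * (c - x))| <= 1.
  by rewrite normrM mulr_ile1// ler_norml sin_geN1 sin_le1.
by move: h; rewrite ler_norml /bump => /andP[h1 h2]; apply/andP; split; lra.
Qed.

Let bump_lt c x : 0 < c <= 1 -> 0 < x < 1 -> x != c ->
  (bump c x != 2^-1) * ((bump c x < 2^-1)%R = (x < c)).
Proof.
move=> /andP[c0 c1] /andP[x0 x1] xc; have pi0 := pi_gt0 R.
have s1 : 0 < sin (pi * x).
  by rewrite sin_gt0_pi// mulr_gt0//= -[ltRHS]mulr1 ltr_pM2l.
rewrite /bump; case: (ltgtP x c) xc => // xc _.
- have s2 : 0 < sin (pi * (c - x)).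
    rewrite sin_gt0_pi// mulr_gt0 ?subr_gt0//= -[ltRHS]mulr1 ltr_pM2l//; lra.
  have := mulr_gt0 s1 s2; move: (sin _ * sin _) => s s0.
  by split; [apply/eqP|]; lra.
- have s2 : 0 < sin (pi * (x - c)).
    rewrite sin_gt0_pi// mulr_gt0 ?subr_gt0//= -[ltRHS]mulr1 ltr_pM2l//; lra.
  have := mulr_gt0 s1 s2; rewrite -[c - x]opprB mulrN sinN mulrN opprK.
  move: (sin _ * sin _) => s s0.
  by split; [apply/eqP; lra|apply/negbTE; rewrite -leNgt; lra].
Qed.

Let bumpP c : {poly R[i]} := (2^-1 + cos (pi * c) / 4)%:C%C *: 'X
  - (8^-1%:C%C * expi (- (pi * c))) *: 'X^2 - (8^-1%:C%C * expi (pi * c))%:P.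

Let bump_poly c x : (bump c x)%:C%C = expi (- (2 * pi * x)) * (bumpP c).[expi (2 * pi * x)].
Proof.
have -> e : (bumpP c).[e] = (2^-1 + cos (pi * c) / 4)%:C%C * e
  - 8^-1%:C%C * expi (- (pi * c)) * e ^+ 2 - 8^-1%:C%C * expi (pi * c).
  by rewrite /bumpP !(hornerD, hornerN, hornerZ, hornerC, hornerX, hornerXn).
have -> : expi (- (2 * pi * x)) * ((2^-1 + cos (pi * c) / 4)%:C%C * expi (2 * pi * x)
  - 8^-1%:C%C * expi (- (pi * c)) * expi (2 * pi * x) ^+ 2 -
  8^-1%:C%C * expi (pi * c)) = (2^-1 + cos (pi * c) / 4)%:C%C
  - 8^-1%:C%C * (expi (2 * pi * x - pi * c) + expi (- (2 * pi * x - pi * c))).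
  rewrite opprB !expiD; have := expiNr (2 * pi * x).
  move: (expi (- _)) (expi (2 * _ * _)) => u v uv.
  have -> : forall (a b d e : R[i]), u * (a * v - b * d * v ^+ 2 - b * e) =
     a * (u * v) - b * (v * d * (u * v) + e * u) by move=> *; ring.
  by rewrite uv !mulr1.
set t := _ - pi * c; apply/eqP; rewrite eq_complex /= !mul0r !subr0 !addr0 sinN cosN.
rewrite subrr mulr0 oppr0 addr0 eqxx andbT /bump; apply/eqP.
have -> : cos t = cos (pi * x + (pi * x - pi * c)) by congr cos; rewrite /t; ring.
have -> : cos (pi * c) = cos (pi * x - (pi * x - pi * c)) by congr cos; ring.
have -> : sin (pi * (c - x)) = - sin (pi * x - pi * c).
  by rewrite -sinN; congr sin; ring.
by rewrite (cosB (pi * x) (pi * x - pi * c)) (cosD (pi * x) (pi * x - pi * c)); field.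
Qed.

Let approx c n x := (1 - bump c x ^+ n) ^+ (2 ^ n).

Let approxE c n x : (approx c n x)%:C%C =
  expi (- ((n * 2 ^ n)%:R * (2 * pi * x))) * (('X^n - bumpP c ^+ n) ^+ (2 ^ n)).[expi (2 * pi * x)].
Proof.
rewrite /approx rmorphXn rmorphB rmorph1 rmorphXn /= bump_poly.
move: (bumpP c) => P; rewrite horner_exp hornerD hornerN hornerXn horner_exp.
have -> : expi (- ((n * 2 ^ n)%:R * (2 * pi * x))) = expi (- (2 * pi * x)) ^+ n ^+ (2 ^ n).
  by rewrite !expiX natrM; congr expi; ring.
have h : expi (- (2 * pi * x)) ^+ n * expi (2 * pi * x) ^+ n = 1.
  by rewrite -exprMn expiNr expr1n.
by rewrite -exprMn mulrBr h exprMn.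
Qed.

Lemma square_null (s : seq R) : leb2.-negligible [set z | z.2 \in s].
Proof.
have ms : measurable ([set x | x \in s] : set (measurableTypeR R)).
  by apply: countable_measurable; [exact: measurable_set1|exact/finite_set_countable/finite_seq].
exists (setT `*` [set x | x \in s]); split.
- exact: measurableX.
- have s0 : leb [set x | x \in s] = 0%E.
    by apply: countable_lebesgue_measure0; exact/finite_set_countable/finite_seq.
  by rewrite product_measure1E// [Y in (_ * Y)%E]s0 mule0.
- by move=> z /= zs; split.
Qed.

Lemma fourier_uniqueness (g : X -> R[i]) :
  cintegrable leb2 sq g ->
  (forall (A : set (measurableTypeR R)) (m : int), measurable A ->
     cintegral leb2 sq (fun z => (\1_A z.1)%:C%C * (expi (2 * pi * (m%:~R * z.2)) * g z)) = 0) ->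
  {ae leb2, forall z, sq z -> g z = 0}.
Proof.
move=> gi g0; have msq := @measurable_square01 R.
have m1 : measurable_fun sq (fun z : X => z.1 : measurableTypeR R).
  exact: measurable_funS measurable_fst.
have m2 : measurable_fun sq (fun z : X => z.2 : measurableTypeR R).
  exact: measurable_funS measurable_snd.
have mA A : measurable A -> measurable_fun sq (fun z : X => \1_A z.1 : R).
  by move=> mA; apply: (measurableT_comp _ m1); exact: measurable_indic.
have iAe A m : measurable A -> cintegrable leb2 sq
    (fun z => (\1_A z.1)%:C%C * (expi (2 * pi * (m%:~R * z.2)) * g z)).
  move=> hA; apply: cintegrableM_bounded => //.
  - by split; [exact: mA|exact: measurable_cst].
  - move=> z _ /=; rewrite normr0 ler01 indicE.
    by case: (_ \in _); rewrite ?normr1 ?normr0.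
  - apply: cintegrableM_bounded => //; last by move=> z _; exact: expi_le1.
    apply: measurable_expi; apply: measurable_funM => //.
    by apply: measurable_funM.
have key A c n : measurable A ->
    cintegral leb2 sq (fun z => (\1_A z.1 * approx c n z.2)%:C%C * g z) = 0.
  move=> hA; pose q := ('X^n - bumpP c ^+ n) ^+ (2 ^ n).
  pose F (i : 'I_(size q)) (z : X) :=
    (\1_A z.1)%:C%C * (expi (2 * pi * ((i%:Z - (n * 2 ^ n)%:Z)%:~R * z.2)) * g z).
  rewrite (_ : (fun z => _) = fun z => \sum_(i < size q) q`_i * F i z).
    have [_ ->] := cintegral_comb msq (index_enum _) (fun i : 'I_(size q) => q`_i)
      (fun i => iAe A (i%:Z - (n * 2 ^ n)%:Z) hA).
    by rewrite big1// => i _; rewrite g0 ?mulr0.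
  apply/funext => z; rewrite rmorphM /= approxE horner_coef -/q.
  rewrite mulr_sumr mulr_sumr mulr_suml; apply: eq_bigr => i _; rewrite /F.
  have -> : expi (2 * pi * ((i%:Z - (n * 2 ^ n)%:Z)%:~R * z.2)) =
      expi (- ((n * 2 ^ n)%:R * (2 * pi * z.2))) * expi (2 * pi * z.2) ^+ i.
    by rewrite expiX -expiD rmorphB /= -!pmulrn; congr expi; ring.
  by ring.
have real_key (r : X -> R) :
    leb2.-integrable sq (fun z => (r z)%:E) ->
    (forall A c n, measurable A ->
      \int[leb2]_(z in sq) (\1_A z.1 * approx c n z.2 * r z) = 0) ->
    {ae leb2, forall z, sq z -> (r z)%:E = 0%E}.
  move=> ir hr.
  have mr : measurable_fun sq r by move: (ir) => /measurable_int/measurable_EFinP.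
  have mapprox c n : measurable_fun sq (fun z : X => approx c n z.2).
    apply: (measurableT_comp (f := approx c n)) m2.
    have msin : measurable_fun setT (@sin R).
      by apply: continuous_measurable_fun; exact: continuous_sin.
    apply: measurable_funX; apply: measurable_funB; first exact: measurable_cst.
    apply: measurable_funX; apply: measurable_funM; last exact: measurable_cst.
    apply: measurable_funB; first exact: measurable_cst.
    apply: measurable_funM; apply: (measurableT_comp msin); apply: measurable_funM;
      do ?[exact: measurable_cst|exact: measurable_id].
    by apply: measurable_funB; [exact: measurable_cst|exact: measurable_id].
  pose f A c n (z : X) := (\1_A z.1 * approx c n z.2 * r z)%:E.
  have mf A c n : measurable A -> measurable_fun sq (f A c n).
    by move=> hA; apply/measurable_EFinP; do !apply: measurable_funM => //; exact: mA.
  have f_le A c n z : (`|f A c n z| <= `|(r z)%:E|)%E.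
    rewrite lee_fin !normrM ler_piMl// -normrM normrM mulr_ile1//.
      by rewrite indicE; case: (_ \in _); rewrite ?normr1 ?normr0.
    have /andP[b0 b1] := bump01 c z.2.
    rewrite normrX exprn_ile1// ger0_norm ?subr_ge0 ?exprn_ile1//.
    by rewrite gerBl exprn_ge0.
  have f0 A c n : measurable A -> (\int[leb2]_(z in sq) f A c n z = 0)%E.
    move=> hA; have fi : leb2.-integrable sq (f A c n).
      by apply: (le_integrable msq (mf _ _ _ hA) _ ir) => z _; exact: f_le.
    by rewrite -[LHS]fineK ?(integrable_fin_num msq fi)//; congr EFin; exact: hr.
  have lim0 A b : measurable A ->
      (\int[leb2]_(z in sq) (\1_A z.1 * (z.2 < b)%R%:R * r z)%:E = 0)%E.
    move=> hA; have [b0|b0] := leP b 0.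
      rewrite (eq_integral (cst 0%E)) ?integral0// => z /set_mem[_ /=].
      rewrite in_itv /= => /andP[z0 _].
      by rewrite ltNge (le_trans b0 z0) mulr0 mul0r.
    pose c := Num.min b 1.
    have c01 : 0 < c <= 1 by rewrite lt_min b0 ltr01 ge_min lexx orbT.
    have mlim : measurable_fun sq (fun z : X =>
        (\1_A z.1 * (z.2 < b)%R%:R * r z)%:E).
      apply/measurable_EFinP; apply: measurable_funM => //.
      apply: measurable_funM; first exact: mA.
      rewrite (_ : (fun _ => _) = (fun z : X => \1_(`]-oo, b[%classic) z.2)).
        by apply: (measurableT_comp _ m2); exact: measurable_indic.
      by apply/funext => z; rewrite indicE mem_setE in_itv.
    have aelim : {ae leb2, forall z, sq z ->
        f A c n z @[n --> \oo] --> (\1_A z.1 * (z.2 < b)%R%:R * r z)%:E}.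
      apply: negligibleS (square_null [:: 0; c; 1]) => z /= /not_implyP[[_ /=]].
      rewrite in_itv /= => /andP[z0 z1] ncvg; rewrite !inE.
      apply: contrapT => /negP; rewrite !negb_or => /and3P[n0 nc n1].
      have z01 : 0 < z.2 < 1 by rewrite !lt_neqAle z0 z1 n1 eq_sym n0.
      have [h1 h2] := bump_lt c01 z01 nc.
      apply: ncvg; apply: cvg_EFin; first exact: nearW.
      apply: cvgM; last exact: cvg_cst.
      apply: cvgM; first exact: cvg_cst.
      have := indicator_approx (bump01 c z.2) h1; rewrite h2.
      by rewrite lt_min; have /andP[_ ->] := z01; rewrite andbT.
    have aele : {ae leb2, forall z n, sq z ->
        (`|f A c n z| <= (abse \o (fun z => (r z)%:E)) z)%E}.
      by apply: aeW => z n _; exact: f_le.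
    have [_ _] := dominated_convergence msq (fun n => mf A c n hA) mlim aelim
      (integrable_abse ir) aele.
    under eq_fun do rewrite f0//.
    by move=> h; rewrite -(cvg_lim _ h)// lim_cst.
  apply: square_integral_eq0 => //.
  - move=> A hA; rewrite integral_mkcondr -[RHS](lim0 A 2 hA).
    apply: eq_integral => z /set_mem[_ /=]; rewrite in_itv /= => /andP[_ z1].
    rewrite (le_lt_trans z1) ?ltr1n// mulr1 patchE indicE.
    by rewrite (_ : (z \in _) = (z.1 \in A))// ; case: ifP; rewrite ?mul1r ?mul0r.
  - move=> A b hA; rewrite -setIA integral_mkcondr -[RHS](lim0 A b hA).
    apply: eq_integral => z _; rewrite patchE indicE.
    rewrite (_ : (z \in _) = (z.1 \in A) && (z.2 < b)).
      by case: (z.1 \in A); case: (z.2 < b); rewrite ?(mul1r,mul0r,mulr1,mulr0).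
    rewrite in_setI; congr andb.
    by rewrite [LHS](_ : _ = (z.2 \in `]-oo, b[%classic))// mem_setE in_itv.
have [gr gi2] := gi.
have r0 A c n : measurable A -> \int[leb2]_(z in sq) (\1_A z.1 * approx c n z.2 * Re (g z)) = 0.
  move=> hA; have [+ _] := key A c n hA; move=> <-.
  by apply: eq_Rintegral => z _; case: (g z) => x y /=; rewrite mul0r subr0.
have i0 A c n : measurable A -> \int[leb2]_(z in sq) (\1_A z.1 * approx c n z.2 * Im (g z)) = 0.
  move=> hA; have [_] := key A c n hA; move=> <-.
  by apply: eq_Rintegral => z _; case: (g z) => x y /=; rewrite mul0r addr0.
apply: filterS2 (real_key _ gr r0) (real_key _ gi2 i0) => z h1 h2 sz.
have [h1'] := h1 sz; have [h2'] := h2 sz.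
by apply/eqP; rewrite eq_complex /= h1' h2' eqxx.
Qed.
End FourierUniqueness.

(** * The Zak transform *)

Section Zak.
Context {R : realType}.
Variables (x1 : rat) (a : int).
Local Notation q := (qden x1).
Local Notation V := (fin_space R x1).
Local Notation sq := (@square01 R).
Local Notation leb2 := (@lebesgue_measure R \x @lebesgue_measure R)%E.
Local Notation L2sq := (L2 leb2 (@measurable_square01 R) V).
Local Notation X := (measurableTypeR R * measurableTypeR R)%type.
Local Notation pr := (q%:R * ratr x1 : R).

Hypothesis a_inv : (a * numq x1 = 1 %[mod q%:Z])%Z.

Lemma pseq_char_subproof (i : int) :
  (fun k : int => ((k == i %[mod q%:Z])%Z)%:R) \in periodic_pred (R := R) q.
Proof. by apply/asboolP => k; rewrite modzDr. Qed.

Definition pseq_char (i : int) : V := PSeq (pseq_char_subproof i).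

Lemma pseq_charE i k : (pseq_char i : pseq R q) k = ((k == i %[mod q%:Z])%Z)%:R.
Proof. by []. Qed.

(* [a] is an inverse of [p] modulo [q], so translating [k] by [shiftc t] changes
   [k p] by the integer part of [p t] modulo [q]: it replaces the parameter [p t]
   of the second coordinate by its fractional part. *)
Definition shiftc (t : R) : int := a * Num.floor (pr * t).

Definition zterm (u : measurableTypeR R -> R[i]) (z : X) (j : int) : V :=
  (u (z.1 + j%:~R) * expi (- (2 * pi / q%:R * (z.2 * j%:~R)))) *:
    pseq_char (j + shiftc z.1).

Definition zak (r : seq int) u (z : X) : V := \sum_(j <- r) zterm u z j.

(* For [u] of bounded support only finitely many terms are nonzero, and [w] is
   the Zak transform of [u]; quantifying over all large [r] avoids choosing a
   window and makes [zak_rel] visibly linear and translation invariant. *)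
Definition zak_rel (u : L2R R) (w : L2sq) := exists r0 : seq int, forall r,
  uniq r -> {subset r0 <= r} -> forall z, sq z -> w z = zak r u z.

Lemma pseq_scaleE c (u : pseq R q) k : (c *: u) k = c * u k.
Proof. by []. Qed.

Lemma pseq_bigE (r : seq int) (F : int -> pseq R q) k :
  (\sum_(j <- r) F j) k = \sum_(j <- r) F j k.
Proof. by elim/big_rec2 : _ => // i y z _ <-. Qed.

Lemma zak_lin r b u v z :
  zak r (fun s => b * u s + v s) z = b *: zak r u z + zak r v z.
Proof.
rewrite /zak scaler_sumr -big_split /=; apply: eq_bigr => j _.
by rewrite /zterm scalerA -scalerDl; congr (_ *: _); ring.
Qed.

Lemma zak_rel_lin b u w u' w' : zak_rel u w -> zak_rel u' w' ->
  zak_rel (b *: u + u') (b *: w + w').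
Proof.
move=> [r0 h] [r0' h']; exists (r0 ++ r0') => r ur sr z sz.
rewrite L2_linE (h r)//; last by move=> j jr; rewrite sr// mem_cat jr.
rewrite (h' r)//; last by move=> j jr; rewrite sr// mem_cat jr orbT.
by rewrite -zak_lin.
Qed.

Lemma zak_rel_rep (n : heis int) u w (h : R) : h = ratr x1 -> zak_rel u w ->
  zak_rel (restrict_rep (heis_inclM R) (schrodinger h) n u)
    (direct_integral leb2 (@measurable_square01 R)
       (rho := fun x => rho_fin x1 (fracpart (pr * x.1)) x.2)
       (@measurable_rho_fin_frac R x1 pr) n w).
Proof.
move=> hE [r0 hr0]; exists [seq j - hx n | j <- r0] => r ur sr z sz.
have q0 : q%:R != 0 :> R by rewrite pnatr_eq0 -lt0n qden_gt0.
have wz : w z = \sum_(j <- r) zterm u z (j + hx n).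
  rewrite (hr0 [seq j + hx n | j <- r])//; first by rewrite /zak big_map.
    by rewrite map_inj_uniq//; exact: addIr.
  move=> j jr0; rewrite -(subrK (hx n) j); apply: map_f.
  by apply: sr; exact: map_f.
apply: pseq_eq => k; rewrite pseq_bigE.
rewrite [LHS]/= /rho_fin_fun wz pseq_bigE mulr_sumr.
apply: eq_bigr => j _; rewrite /zterm !pseq_scaleE !pseq_charE.
have -> : (k + hx n == j + hx n + shiftc z.1 %[mod q%:Z])%Z =
    (k == j + shiftc z.1 %[mod q%:Z])%Z.
  by rewrite addrAC eqz_modDr.
have [kj|_] := boolP (_ == _ %[mod _])%Z; last by rewrite !mulr0.
have -> s : restrict_rep (heis_inclM R) (schrodinger h) n u s =
    schrodinger_fun h (heis_incl R n) u s by [].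
rewrite /schrodinger_fun; have [-> -> ->] := heis_incl_coord R n.
rewrite !mulr1 /rho_fin_phase intrD (addrA z.1).
rewrite mulrCA -expiD [in RHS]mulrAC -expiD [RHS]mulrC; congr (_ * _).
move: kj a_inv => /=; rewrite eqz_mod_dvd => /dvdzP[l kl] /eqP.
rewrite eqz_mod_dvd => /dvdzP[l' al].
set b := Num.floor (pr * z.1).
have prE : pr = (numq x1)%:~R := qdenM R x1.
have klR : k%:~R = j%:~R + a%:~R * b%:~R + l%:~R * q%:R :> R.
  have -> : k = l * q%:Z + (j + shiftc z.1) by rewrite -kl subrK.
  by rewrite !(rmorphD, rmorphM) /= -!pmulrn addrC.
have alR : a%:~R * pr = 1 + l'%:~R * q%:R :> R.
  rewrite prE -rmorphM /=; have -> : a * numq x1 = l' * q%:Z + 1 by rewrite -al subrK.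
  by rewrite !(rmorphD, rmorphM) /= -!pmulrn addrC.
apply: (@expi_periodic _ _ _ (hy n * (b * l' + l * numq x1))).
rewrite !(rmorphD, rmorphM) /= -prE hE /fracpart -/b klR.
have -> : l'%:~R = (a%:~R * pr - 1) / q%:R by rewrite alR addrC addrA addNr add0r mulfK.
by field.
Qed.
End Zak.

Lemma measurable_fun_floor {R : realType} {d} {Y : measurableType d} (D : set Y)
    (f : Y -> R) (G : int -> R) : measurable_fun D f ->
  measurable_fun D (fun y => G (Num.floor (f y))).
Proof.
move=> mf mD B mB.
pose F (n : int) := D `&` f @^-1`
    (if pselect (B (G n)) then [set` `[n%:~R, (n + 1)%:~R[%R] else set0).
rewrite (_ : _ `&` _ = \bigcup_n F n).
  apply: countable_bigcupT_measurable; first exact: countableP.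
  move=> n; apply: mf => //; case: pselect => [BG|BG]; first exact: measurable_itv.
  exact: measurable0.
apply/seteqP; split => [y [Dy By]|y [n _ [Dy]]].
  exists (Num.floor (f y)) => //; split => //=; case: pselect => //= _.
  by rewrite in_itv /=; exact: floor_itv.
case: pselect => //= Bn; rewrite in_itv /= => fn; split => //=.
by rewrite (floor_def fn).
Qed.

Lemma continuous_expi_parts {R : realType} (c : R) :
  continuous (fun x : R => cos (c * x)) /\ continuous (fun x : R => sin (c * x)).
Proof.
split => x; apply: continuous_comp; do ?[exact: continuous_cos|exact: continuous_sin];
  by apply: cvgM; [exact: cvg_cst|exact: cvg_id].
Qed.

Lemma Rintegral01_derive {R : realType} (F f : R -> R) :
  (forall x : R, is_derive x (1 : R) F (f x)) -> continuous f ->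
  \int[@lebesgue_measure R]_(x in `[0, 1]) f x = F 1 - F 0.
Proof.
move=> dF cf; have cF : continuous F.
  by move=> x; apply: differentiable_continuous; apply/derivable1_diffP; case: (dF x).
rewrite /Rintegral (@continuous_FTC2 _ f F 0 1)//.
- exact: continuous_subspaceT.
- split; first by move=> x _; case: (dF x).
  + by apply: cvg_at_right_filter; exact: cF.
  + by apply: cvg_at_left_filter; exact: cF.
- by move=> x _; rewrite derive1E; case: (dF x).
Qed.

Lemma cintegral_expi {R : realType} (m : int) :
  cintegrable (@lebesgue_measure R) `[0, 1] (fun x => expi (2 * pi * m%:~R * x)) /\
  cintegral (@lebesgue_measure R) `[0, 1] (fun x => expi (2 * pi * m%:~R * x)) =
  (m == 0)%:R.
Proof.
have [cc cs] := @continuous_expi_parts R (2 * pi * m%:~R).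
split.
  by split; apply: continuous_compact_integrable => //; try exact: segment_compact;
     exact: continuous_subspaceT.
have [->|m0] := eqVneq m 0.
  rewrite /cintegral /=; under eq_Rintegral do rewrite mulr0 mul0r cos0.
  under [X in Complex _ X]eq_Rintegral do rewrite mulr0 mul0r sin0.
  rewrite !Rintegral_cst//= lebesgue_measure_itv /= lte_fin ltr01 mul0r mul1r.
  by rewrite -EFinB subr0.
have k0 : 2 * pi * m%:~R != 0 :> R.
  by rewrite !mulf_neq0 ?pnatr_eq0 ?intr_eq0// gt_eqF ?pi_gt0.
set k := 2 * pi * m%:~R in cc cs k0 *.
have dk x : is_derive x (1 : R) (fun x : R => k * x) k.
  apply: (is_derive_eq (is_deriveZ k (is_derive_id x (1 : R)))).
  by rewrite [LHS]mulr1.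
have dsin x : is_derive x (1 : R) (fun x : R => k^-1 * sin (k * x)) (cos (k * x)).
  apply: (is_derive_eq (is_deriveZ k^-1 (is_derive1_comp (is_derive_sin (k * x)) (dk x)))).
  by rewrite [LHS]mulrCA mulVf// mulr1.
have dcos x : is_derive x (1 : R) (fun x : R => - k^-1 * cos (k * x)) (sin (k * x)).
  apply: (is_derive_eq (is_deriveZ (- k^-1) (is_derive1_comp (is_derive_cos (k * x)) (dk x)))).
  by rewrite [LHS]mulrA mulrNN mulrAC mulVf// mul1r.
have [kc ks] : cos k = 1 /\ sin k = 0.
  by have := expi2pi R m; rewrite -/k => -[].
rewrite /cintegral /= (Rintegral01_derive dsin)// (Rintegral01_derive dcos)//.
by rewrite !mulr1 !mulr0 kc ks cos0 sin0 !mulr0 !subrr.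
Qed.

Section ZakNorm.
Context {R : realType}.
Variables (x1 : rat) (a : int).
Local Notation q := (qden x1).
Local Notation V := (fin_space R x1).
Local Notation sq := (@square01 R).
Local Notation leb := (@lebesgue_measure R).
Local Notation leb2 := (leb \x leb)%E.
Local Notation X := (measurableTypeR R * measurableTypeR R)%type.
Local Notation pr := (q%:R * ratr x1 : R).
Local Notation zak := (zak x1 a).
Local Notation pchar := (@pseq_char R x1).
Implicit Types (u : measurableTypeR R -> cline R) (r : seq int).

Lemma hip_pseq_char (v : V) i : hip v (pchar i) = (v : pseq R q) i.
Proof.
have q0 : 0 < q%:Z by rewrite ltz_nat qden_gt0.
have iq : (`|(i %% q%:Z)%Z| < q)%N.
  by rewrite -ltz_nat gez0_abs ?modz_ge0 ?ltz_pmod ?gt_eqF.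
have iE : `|(i %% q%:Z)%Z|%:Z = (i %% q%:Z)%Z by rewrite gez0_abs// modz_ge0// gt_eqF.
have -> : pchar i = pseq_delta R (Ordinal iq).
  by apply: pseq_eq => k; rewrite /= iE modz_mod.
by rewrite [LHS]pseq_hip_delta /= iE pseq_mod.
Qed.

Lemma measurable_zak r u :
  (cmeasurable_fun setT (u : measurableTypeR R -> R[i])) ->
  measurable_section sq (zak r u).
Proof.
move=> [mu1 mu2] v; under eq_fun do rewrite hip_suml.
apply: cmeasurable_sum => j; under eq_fun do rewrite hipZl.
have m1 : measurable_fun sq (fun z : X => z.1 : measurableTypeR R).
  exact: measurable_funS measurable_fst.
have m2 : measurable_fun sq (fun z : X => z.2 : measurableTypeR R).
  exact: measurable_funS measurable_snd.
have mj : measurable_fun sq (fun z : X => z.1 + j%:~R : measurableTypeR R).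
  exact: (measurableT_comp (measurable_shift j%:~R) m1).
apply: cmeasurableM; first apply: cmeasurableM.
- by split; [exact: (measurableT_comp mu1 mj)|exact: (measurableT_comp mu2 mj)].
- apply: measurable_expi; apply: measurableT_comp => //.
  by apply: measurable_funM => //; apply: measurable_funM.
- have mp : measurable_fun sq (fun z : X => pr * z.1 : R) by exact: measurable_funM.
  split; first exact: (measurable_fun_floor (fun n => Re (hip (pchar (j + a * n)) v)) mp).
  exact: (measurable_fun_floor (fun n => Im (hip (pchar (j + a * n)) v)) mp).
Qed.

Lemma nsq_zakE r u t x :
  hip (zak r u (t, x)) (zak r u (t, x)) = \sum_(jj <- [seq (j, j') | j <- r, j' <- r])
    (u (t + jj.1%:~R) * (u (t + jj.2%:~R))^*%C * ((jj.1 == jj.2 %[mod q%:Z])%Z)%:R) *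
    expi (2 * pi * ((jj.2 - jj.1) %/ q%:Z)%Z%:~R * x).
Proof.
have q0 : q%:R != 0 :> R by rewrite pnatr_eq0 -lt0n qden_gt0.
rewrite big_allpairs {1}/zak hip_suml; apply: eq_bigr => j _.
rewrite hipZl hipC hip_pseq_char pseq_bigE rmorph_sum mulr_sumr; apply: eq_bigr => j' _.
rewrite /zterm pseq_scaleE pseq_charE eqz_modDr.
have [jj'|_] := boolP (_ == _ %[mod _])%Z; last by rewrite /= !(mulr0, conjc0, mul0r).
rewrite !mulr1 rmorphM [X in _ * X = _](_ : _ = (u (t + j'%:~R))^*%C *
  expi (2 * pi / q%:R * (x * j'%:~R))); last first.
  by congr (_ * _); rewrite [LHS]conj_expi opprK.
rewrite [LHS]/= [RHS]/=.
move: jj'; rewrite eq_sym eqz_mod_dvd => /dvdzP[l /eqP]; rewrite subr_eq => /eqP ->.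
have -> : ((l * q%:Z + j - j) %/ q%:Z)%Z = l.
  by rewrite addrK mulzK// gt_eqF// ltz_nat qden_gt0.
have -> (A B c d : R[i]) : A * c * (B * d) = A * B * (c * d) by ring.
rewrite -expiD; congr (_ * expi _).
rewrite !(rmorphD, rmorphM) /= -pmulrn; by field.
Qed.

(* Parseval on a fiber: characters of distinct [j] are orthogonal, either in
   [k] or, when [j] and [j'] agree modulo [q], in [x]. *)
Lemma nsq_zak_fiber r u t : uniq r ->
  (\int[leb]_(x in `[0%R, 1%R]) (nsq (zak r u (t, x)))%:E =
   \sum_(j <- r) (nsq (u (t + j%:~R)))%:E)%E.
Proof.
move=> ur.
pose A (jj : int * int) := u (t + jj.1%:~R) * (u (t + jj.2%:~R))^*%C *
  ((jj.1 == jj.2 %[mod q%:Z])%Z)%:R.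
pose F (jj : int * int) (x : measurableTypeR R) :=
  expi (2 * pi * ((jj.2 - jj.1) %/ q%:Z)%Z%:~R * x).
have mI : measurable (`[0, 1]%classic : set (measurableTypeR R)) by exact: measurable_itv.
have iF jj : cintegrable leb `[0, 1] (F jj).
  by have [] := @cintegral_expi R ((jj.2 - jj.1) %/ q%:Z)%Z.
have [[iRe _] key] := cintegral_comb mI [seq (j, j') | j <- r, j' <- r] A iF.
pose f x := \sum_(jj <- [seq (j, j') | j <- r, j' <- r]) A jj * F jj x.
rewrite -/f in iRe key; have fE x : nsq (zak r u (t, x)) = Re (f x).
  by rewrite /nsq nsq_zakE.
under eq_integral do rewrite fE.
move: key; rewrite {1}/cintegral => /(congr1 (@complex.Re R)) /= key.
rewrite -[LHS]fineK ?(integrable_fin_num mI iRe)//.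
rewrite [fine _]key big_allpairs raddf_sum sumEFin; congr EFin.
rewrite !big_seq; apply: eq_bigr => j jr.
rewrite raddf_sum (bigD1_seq j)//= big1 => [|j' jj'].
  by rewrite addr0 /A /F /= subrr div0z (@cintegral_expi R 0).2 eqxx !mulr1.
rewrite (@cintegral_expi R ((j' - j) %/ q%:Z)%Z).2 /A /=.
have [h|_] := boolP (_ == _ %[mod _])%Z; last by rewrite mulr0 mul0r.
move: h; rewrite eq_sym eqz_mod_dvd => /dvdzP[l lE].
have q0 : q%:Z != 0 by rewrite gt_eqF// ltz_nat qden_gt0.
rewrite lE mulzK//; have [l0|_] := eqVneq l 0; last by rewrite mulr0.
by move: lE jj'; rewrite l0 mul0r => /eqP; rewrite subr_eq0 => ->.
Qed.
End ZakNorm.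

Section Cells.
Context {R : realType}.
Local Notation leb := (@lebesgue_measure R).

Definition cell (j : int) : set (measurableTypeR R) := [set s | Num.floor s = j].

Lemma cellE j : cell j = `[j%:~R, (j + 1)%:~R[%classic.
Proof.
apply/seteqP; split=> s /=; rewrite in_itv /=; last exact: floor_def.
by move=> <-; exact: floor_itv.
Qed.

Lemma measurable_cell j : measurable (cell j).
Proof. by rewrite cellE; exact: measurable_itv. Qed.

Lemma integral_cell (f : measurableTypeR R -> \bar R) j :
  measurable_fun setT f -> (forall s, 0 <= f s)%E ->
  (\int[leb]_(t in `[0%R, 1%R]) f (t + j%:~R)%R = \int[leb]_(s in cell j) f s)%E.
Proof.
move=> mf f0.
have mfj : measurable_fun setT (fun t : measurableTypeR R => f (t + j%:~R)).
  by apply: (measurableT_comp mf); exact: measurable_shift.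
rewrite -integral_itv_bndo_bndc; last exact: measurable_funS mfj.
rewrite integral_mkcond [RHS]integral_mkcond -[RHS](ge0_integral_shift j%:~R).
- apply: eq_integral => t _; rewrite !patchE cellE !mem_setE !in_itv.
  rewrite [X in _ = if X then _ else _](_ : _ = (0 <= t < 1))//.
  by rewrite /= intrD; apply/idP/idP => /andP[? ?]; apply/andP; split; lra.
- by apply/(measurable_restrictT _ (measurable_cell j)); exact: measurable_funS mf.
- by move=> s; rewrite patchE; case: ifP.
Qed.

Definition enum_int (n : nat) : int := if odd n then Negz n./2 else Posz n./2.

Lemma enum_int_inj : injective enum_int.
Proof.
move=> m n; rewrite /enum_int => e.
rewrite -(odd_double_half m) -(odd_double_half n).
by move: e; case: (odd m); case: (odd n) => // -[->].
Qed.

Lemma enum_int_surj j : exists n, enum_int n = j.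
Proof.
case: j => n; [exists n.*2|exists n.*2.+1]; rewrite /enum_int /= odd_double/=.
  by rewrite doubleK.
by rewrite uphalf_double.
Qed.

Definition window (n : nat) : seq int := [seq enum_int i | i <- iota 0 n].

Lemma window_uniq n : uniq (window n).
Proof. by rewrite map_inj_uniq ?iota_uniq//; exact: enum_int_inj. Qed.

Lemma sub_window (r : seq int) : exists N, forall n, (N <= n)%N -> {subset r <= window n}.
Proof.
elim: r => [|j r [N hN]]; first by exists 0%N.
have [i ij] := enum_int_surj j; exists (maxn N i.+1) => n.
rewrite geq_max => /andP[Nn ni] k; rewrite inE => /predU1P[->|/(hN n Nn)//].
by rewrite -ij; apply: map_f; rewrite mem_iota.
Qed.

Lemma window_integral_cvg (f : measurableTypeR R -> \bar R) :
  measurable_fun setT f -> (forall s, 0 <= f s)%E ->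
  (\sum_(j <- window n) \int[leb]_(t in `[0%R, 1%R]) f (t + j%:~R)%R)%E @[n --> \oo] -->
  (\int[leb]_s f s)%E.
Proof.
move=> mf f0.
have cover : \bigcup_n cell (enum_int n) = setT.
  apply/seteqP; split => // s _; have [n ns] := enum_int_surj (Num.floor s).
  by exists n.
rewrite -cover ge0_integral_bigcup//; last 3 first.
- by move=> n; exact: measurable_cell.
- by rewrite cover.
- apply/trivIsetP => m n _ _ mn; apply/seteqP; split => // s [].
  by rewrite /cell /= => -> /enum_int_inj nm; rewrite nm eqxx in mn.
have := @is_cvg_nneseries _ (fun n => \int[leb]_(x in cell (enum_int n)) f x)%E xpredT 0%N.
move=> /(_ (fun n _ _ => integral_ge0 _ (fun x _ => f0 x))).
apply: cvg_trans; apply: near_eq_cvg; apply: nearW => n.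
rewrite big_map /index_iota subn0; apply: eq_bigr => i _.
by rewrite integral_cell.
Qed.
End Cells.

Section ZakIsometry.
Context {R : realType}.
Variables (x1 : rat) (a : int).
Local Notation q := (qden x1).
Local Notation V := (fin_space R x1).
Local Notation sq := (@square01 R).
Local Notation msq := (@measurable_square01 R).
Local Notation leb := (@lebesgue_measure R).
Local Notation leb2 := (leb \x leb)%E.
Local Notation X := (measurableTypeR R * measurableTypeR R)%type.
Local Notation L2sq := (L2 leb2 msq V).
Local Notation zak := (zak x1 a).
Local Notation zak_rel := (@zak_rel R x1 a).
Implicit Types (u : L2R R) (r : seq int).

Lemma L2R_measurable u : cmeasurable_fun setT (u : measurableTypeR R -> R[i]).
Proof.
have [/(_ (1 : R[i]))] := L2_mem u; rewrite /= /cline_hip.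
by under eq_fun do rewrite conjc1 mulr1.
Qed.

Lemma measurable_nsq_L2R u : measurable_fun setT (fun s => (nsq (u s))%:E).
Proof. by apply/measurable_EFinP/measurable_nsq; have [] := L2_mem u. Qed.

Lemma zak_integral r u : uniq r ->
  (\int[leb2]_(z in sq) (nsq (zak r u z))%:E =
   \sum_(j <- r) \int[leb]_(t in `[0%R, 1%R]) (nsq (u (t + j%:~R)))%:E)%E.
Proof.
move=> ur; have mz : measurable_section sq (zak r u) := measurable_zak a r (L2R_measurable u).
have mN : measurable_fun sq (fun z => (nsq (zak r u z))%:E).
  exact/measurable_EFinP/measurable_nsq.
rewrite integral_mkcond fubini_tonelli1; last 2 first.
- exact/(measurable_restrictT _ msq).
- by move=> z; rewrite patchE; case: ifP => // _; rewrite lee_fin nsq_ge0.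
transitivity (\int[leb]_(t in `[0%R, 1%R]) (\sum_(j <- r) (nsq (u (t + j%:~R)))%:E))%E.
  rewrite [RHS]integral_mkcond; apply: eq_integral => t _.
  rewrite /fubini_F patchE; case: ifP => t01.
    rewrite -(nsq_zak_fiber x1 a u t ur) [RHS]integral_mkcond; apply: eq_integral => x _.
    by rewrite !patchE in_setX t01.
  rewrite (eq_integral (cst 0%E)) ?integral0// => x _.
  by rewrite patchE in_setX t01.
rewrite ge0_integral_sum//.
- move=> j; have mj := measurableT_comp (measurable_nsq_L2R u) (measurable_shift j%:~R).
  by apply: measurable_funS mj.
- by move=> j x _; rewrite lee_fin nsq_ge0.
Qed.

Lemma zak_mem r u : uniq r -> zak r u \in L2_pred leb2 (V := V) msq.
Proof.
move=> ur; have mz : measurable_section sq (zak r u) := measurable_zak a r (L2R_measurable u).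
apply/asboolP; split => //; apply/integrableP; split.
  exact/measurable_EFinP/measurable_nsq.
under eq_integral do rewrite gee0_abs ?lee_fin ?Re_hip_ge0//.
rewrite [ltLHS](zak_integral u ur); apply: lte_sum_pinfty => j _.
rewrite (integral_cell j (measurable_nsq_L2R u)); last by move=> s; rewrite lee_fin nsq_ge0.
apply: (@le_lt_trans _ _ (nsq u)%:E); last by rewrite ltry.
rewrite nsq_L2; apply: ge0_subset_integral => //.
- exact: measurable_cell.
- exact: measurable_nsq_L2R.
- by move=> s _; rewrite lee_fin nsq_ge0.
Qed.

Lemma zak_rel_nsq u w : zak_rel u w -> nsq w = nsq u.
Proof.
move=> [r0 hr0]; have [N hN] := sub_window r0.
have Eu : (nsq u)%:E = (\int[leb]_s (nsq (u s))%:E)%E by rewrite nsq_L2.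
apply: EFin_inj; rewrite Eu.
have := window_integral_cvg (measurable_nsq_L2R u) _.
move=> /(_ (fun s => nsq_ge0 (u s))) h.
apply: (cvg_unique (@ereal_hausdorff R)) h.
apply: cvg_near_cst; exists N => // n Nn.
rewrite nsq_L2 -(zak_integral u (window_uniq n)); apply: eq_integral => z /set_mem sz.
by rewrite (hr0 (window n))// ?window_uniq//; exact: hN.
Qed.

(* The translates by -1 are needed for the single value [t = 1]. *)
Lemma zak_rel_supported r0 u (w : L2sq) : (forall s, Num.floor s \notin r0 -> u s = 0) ->
  let r1 := undup (r0 ++ [seq j - 1 | j <- r0]) in
  (forall z, sq z -> w z = zak r1 u z) -> zak_rel u w.
Proof.
move=> u0 r1 wE; exists r1 => r ur sr z sz; rewrite wE//.
have zz j : j \notin r1 -> zterm x1 a u z j = 0.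
  rewrite mem_undup mem_cat negb_or => /andP[jr0 jr0'].
  rewrite /zterm u0 ?mul0r ?scale0r//.
  case: sz => + _; rewrite /= in_itv /= => /andP[t0 t1].
  have [t1'|t1'] := ltP z.1 1.
  - by rewrite (@floor_def _ _ j)// intrD; apply/andP; split; lra.
  - have -> : z.1 + j%:~R = (j + 1)%:~R by rewrite intrD; lra.
    rewrite intrKfloor; apply: contra jr0' => jr0'.
    by apply/mapP; exists (j + 1) => //; rewrite addrK.
rewrite /zak [RHS](bigID (mem r1)) /= [X in _ = _ + X]big1 ?addr0; last by move=> j; exact: zz.
rewrite -[RHS]big_filter; apply: perm_big; apply: uniq_perm => [||j];
  rewrite ?undup_uniq ?filter_uniq//.
by rewrite mem_filter; case: (boolP (j \in r1)) => // /sr ->.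
Qed.
End ZakIsometry.

Section ZakDense.
Context {R : realType}.
Variables (x1 : rat) (a : int).
Local Notation q := (qden x1).
Local Notation leb := (@lebesgue_measure R).
Local Notation zak_rel := (@zak_rel R x1 a).
Implicit Types (u : L2R R) (P : pred int).

Definition cut P u (s : measurableTypeR R) : cline R := (P (Num.floor s))%:R * u s.

Lemma cut_hip P u s v : hip (cut P u s) v = (P (Num.floor s))%:R * hip (u s) v.
Proof. by rewrite /= /cline_hip mulrA. Qed.

Lemma cut_mem P u : cut P u \in L2_pred leb (V := cline R) measurableT.
Proof.
have [mu su] := L2_mem u.
have mc : measurable_section setT (cut P u).
  move=> v; under eq_fun do rewrite cut_hip; apply: cmeasurableM; last exact: mu.
  split; first exact: (measurable_fun_floor (fun n => Re (P n)%:R) (@measurable_id _ _ _)).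
  exact: (measurable_fun_floor (fun n => Im (P n)%:R) (@measurable_id _ _ _)).
apply/asboolP; split => //; apply: (le_integrable measurableT _ _ su).
  exact/measurable_EFinP/measurable_nsq.
move=> s _; rewrite lee_fin !ger0_norm ?Re_hip_ge0//.
rewrite cut_hip; case: (P _); last by rewrite mul0r Re_hip_ge0.
by rewrite mul1r Re_hipC cut_hip; case: (P _); rewrite ?mul1r ?mul0r ?Re_hip_ge0.
Qed.

Lemma zak_rel_dense u (e : R) : 0 < e ->
  exists u' w', zak_rel u' w' /\ nsq (u' - u) < e.
Proof.
move=> e0; pose P n (j : int) := j \in window n.
pose u_ n : L2R R := L2Fun (cut_mem (P n) u).
have uE n s : (u_ n - u : L2_sort _ _ _) s =
    ((Num.floor s \in window n)%:R * (u s : R[i]) - u s : cline R) by [].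
have h : (nsq (u_ n - u))%:E @[n --> \oo] --> 0%E.
  have := @dominated_convergence _ _ _ leb setT measurableT
    (fun n s => (nsq ((u_ n - u : L2_sort _ _ _) s))%:E) (cst 0%E) (fun s => (nsq (u s))%:E).
  case.
  - move=> n; apply/measurable_EFinP/measurable_nsq.
    by have [] := L2_mem (u_ n - u : L2_sort _ _ _).
  - exact: measurable_cst.
  - apply: aeW => s _; apply: cvg_near_cst.
    have [N hN] := sub_window [:: Num.floor s].
    exists N => // n /hN/(_ (Num.floor s)) sn.
    by rewrite uE sn ?inE// mul1r subrr nsq0.
  - by have [] := L2_mem u.
  - apply: aeW => s n _; rewrite lee_fin ger0_norm ?nsq_ge0// uE.
    case: (_ \in _); first by rewrite mul1r subrr nsq0 nsq_ge0.
    by rewrite mul0r add0r nsqN.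
  - move=> _ _; rewrite integral0 => h; apply: cvg_trans h.
    by apply: near_eq_cvg; apply: nearW => n; rewrite nsq_L2.
have [n un] : exists n, nsq (u_ n - u) < e.
  move/fine_cvg : h => /cvgrPdist_lt/(_ e e0)[N _ /(_ N (leqnn N))] /=.
  by rewrite sub0r normrN ger0_norm ?nsq_ge0//; exists N.
pose r1 := undup (window n ++ [seq j - 1 | j <- window n]).
exists (u_ n), (L2Fun (zak_mem x1 a (u_ n) (undup_uniq _ : uniq r1))); split => //.
apply: zak_rel_supported => // s; rewrite /= /cut /P => /negbTE ->.
by rewrite mul0r.
Qed.
End ZakDense.

Section ZakTotal.
Context {R : realType}.
Variables (x1 : rat) (a : int).
Hypothesis x1_ge0 : 0 <= x1.
Local Notation q := (qden x1).
Local Notation V := (fin_space R x1).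
Local Notation sq := (@square01 R).
Local Notation msq := (@measurable_square01 R).
Local Notation leb := (@lebesgue_measure R).
Local Notation leb2 := (leb \x leb)%E.
Local Notation X := (measurableTypeR R * measurableTypeR R)%type.
Local Notation L2sq := (L2 leb2 msq V).
Local Notation zak := (zak x1 a).
Local Notation zak_rel := (@zak_rel R x1 a).
Local Notation pr := (q%:R * ratr x1 : R).
Local Notation shiftc := (@shiftc R x1 a).

Section TestFunction.
Variables (A : set (measurableTypeR R)) (mA : measurable A) (n : int).

(* For [0 <= t < 1], the single nonzero term of [zak] at [(t, x)] is
   the one of residue [n]. *)
Definition test_fun (s : measurableTypeR R) : cline R :=
  (\1_A (fracpart s) * (Num.floor s == n - shiftc (fracpart s))%:R)%:C%C.

(* As [0 <= p], the integer part of [p t] lies in [0, p] for [0 <= t < 1]. *)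
Let r0 : seq int := [seq n - a * i%:Z | i <- iota 0 `|numq x1|.+1].

Lemma fracpart_itv (s : R) : 0 <= fracpart s < 1.
Proof.
have /andP[h1] := floor_itv s; rewrite intrD => h2.
by rewrite /fracpart; apply/andP; split; lra.
Qed.

Lemma shiftc_mem (t : R) : 0 <= t < 1 -> n - shiftc t \in r0.
Proof.
move=> /andP[t0 t1].
have pE : pr = (numq x1)%:~R := qdenM R x1.
have p0 : 0 <= numq x1 by rewrite numq_ge0.
have p0R : 0 <= pr by rewrite pE ler0z.
have f0 : 0 <= Num.floor (pr * t) by rewrite floor_ge_int mulr_ge0.
have f1 : Num.floor (pr * t) <= numq x1.
  rewrite -(@intrKfloor R (numq x1)) le_floor// -pE.
  by rewrite -[leRHS]mulr1 ler_wpM2l// ltW.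
apply/mapP; exists `|Num.floor (pr * t)|%N; last by rewrite gez0_abs.
by rewrite mem_iota /= add0n ltnS -lez_nat !gez0_abs.
Qed.

Lemma test_fun_supported s : Num.floor s \notin r0 -> test_fun s = 0.
Proof.
move=> sr; rewrite /test_fun; case: eqP => [sE|_]; last by rewrite mulr0.
by move: sr; rewrite sE shiftc_mem// fracpart_itv.
Qed.

Lemma test_fun_mem : test_fun \in L2_pred leb (V := cline R) measurableT.
Proof.
have mfl : measurable_fun setT (fun s : measurableTypeR R => (Num.floor s)%:~R : R).
  exact: (measurable_fun_floor intr (@measurable_id _ _ _)).
have mfr : measurable_fun setT (fun s : measurableTypeR R => fracpart s : measurableTypeR R).
  by apply: measurable_funB => //; exact: measurable_id.
have msh : measurable_fun setT (fun s : measurableTypeR R => (n - shiftc (fracpart s))%:~R : R).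
  apply: (measurable_fun_floor (fun k => (n - a * k)%:~R)).
  by apply: measurable_funM => //; exact: measurable_cst.
have mt : measurable_fun setT (fun s : measurableTypeR R =>
    \1_A (fracpart s) * (Num.floor s == n - shiftc (fracpart s))%:R : R).
  apply: measurable_funM; first by apply: (measurableT_comp _ mfr); exact: measurable_indic.
  rewrite (_ : (fun s => _) = fun s : measurableTypeR R =>
     (Num.floor ((Num.floor s)%:~R - (n - shiftc (fracpart s))%:~R : R) == 0)%:R).
    by apply: (measurable_fun_floor (fun k => (k == 0)%:R)); exact: measurable_funB.
  by apply/funext => s; rewrite -intrB intrKfloor subr_eq0.
have mtest : measurable_section setT test_fun.
  move=> v; apply: cmeasurableM; last exact: cmeasurable_cst.
  by split => //; exact: measurable_cst.
apply/asboolP; split => //.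
have icell j : leb.-integrable setT (fun s => (\1_(cell j) s)%:E).
  by rewrite cellE; exact: integrable_indic_itv.
have isum := integrable_sum (P := xpredT) measurableT r0 (fun j _ => icell j).
apply: (le_integrable measurableT _ _ isum).
  by apply/measurable_EFinP; exact: measurable_nsq mtest.
move=> s _; rewrite sumEFin lee_fin ger0_norm ?Re_hip_ge0//.
rewrite [leRHS]ger0_norm; last by apply: sumr_ge0 => j _.
have [sr|/test_fun_supported ->] := boolP (Num.floor s \in r0); last first.
  by rewrite hip0l; apply: sumr_ge0 => j _.
apply: (@le_trans _ _ 1).
  rewrite /= /cline_hip /test_fun /= oppr0 !mulr0 subr0 indicE.
  by case: (_ \in _); case: (_ == _); rewrite !(mul0r, mulr0, mulr1).
move: sr; generalize r0 => r sr.
rewrite (big_rem (P := xpredT) _ sr) /= indicE mem_set//.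
by rewrite -[leLHS]addr0; apply: lerD; [exact: lexx|apply: sumr_ge0 => j _].
Qed.

Lemma zak_test_fun (r1 := undup (r0 ++ [seq j - 1 | j <- r0])) t x : 0 <= t < 1 ->
  zak r1 test_fun (t, x) =
  ((\1_A t)%:C%C * expi (- (2 * pi / q%:R * (x * (n - shiftc t)%:~R)))) *: pseq_char x1 n.
Proof.
move=> t01; have tj j : Num.floor (t + j%:~R) = j.
  by apply: floor_def; rewrite intrD; apply/andP; split; case/andP: t01 => *; lra.
have r1j : n - shiftc t \in r1 by rewrite mem_undup mem_cat shiftc_mem.
rewrite /zak (bigD1_seq _ r1j) ?undup_uniq//= big1 ?addr0 => [|j jn].
  by rewrite /zterm /test_fun /fracpart /= tj addrK eqxx mulr1 subrK.
by rewrite /zterm /test_fun /fracpart /= tj addrK (negbTE jn) mulr0 mul0r scale0r.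
Qed.

End TestFunction.

Lemma square_null_fst (c : R) : leb2.-negligible [set z | z.1 = c].
Proof.
have mc : measurable ([set c] : set (measurableTypeR R)) by exact: measurable_set1.
exists ([set c] `*` setT); split; first exact: measurableX.
- by rewrite product_measure1E// [Y in (Y * _)%E]lebesgue_measure_set1 mul0e.
- by move=> z /= zc; split.
Qed.

Lemma zak_rel_total (w : L2sq) : (forall u v, zak_rel u v -> hip v w = 0) -> nsq w = 0.
Proof.
move=> orth; have [mw sw] := L2_mem w.
have m1 : measurable_fun sq (fun z : X => z.1 : measurableTypeR R).
  exact: measurable_funS measurable_fst.
have m2 : measurable_fun sq (fun z : X => z.2 : measurableTypeR R).
  exact: measurable_funS measurable_snd.
have msh : measurable_fun sq (fun z : X => (shiftc z.1)%:~R : R).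
  by apply: (measurable_fun_floor (fun k => (a * k)%:~R)); exact: measurable_funM.
suff coord0 k : {ae leb2, forall z, sq z -> (w z : pseq R q) k = 0}.
  have all0 : {ae leb2, forall z, forall i : 'I_q, sq z -> (w z : pseq R q) (i : nat)%:Z = 0}.
    exact: filter_forall.
  apply: EFin_inj; rewrite nsq_L2 (@ge0_ae_eq_integral _ _ _ _ _ _ (cst 0%E)) ?integral0//.
  - exact: msq.
  - by apply/measurable_EFinP; exact: measurable_nsq mw.
  - by move=> z _; rewrite lee_fin nsq_ge0.
  - apply: filterS all0 => z z0 sz; congr EFin.
    by rewrite /nsq /= /pseq_hip big1// => i _; rewrite z0// mul0r.
pose gauge (z : X) : V :=
  expi (- (2 * pi / q%:R * (z.2 * (k%:~R - (shiftc z.1)%:~R)))) *: pseq_char x1 k.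
have mgauge : measurable_section sq gauge.
  move=> v; under eq_fun do rewrite hipZl; apply: cmeasurableM; last exact: cmeasurable_cst.
  apply: measurable_expi; apply: measurableT_comp => //.
  by do ?[apply: measurable_funM => //]; apply: measurable_funB.
have gauge1 z : nsq (gauge z) = nsq (pseq_char x1 k).
  by rewrite nsqZ; have := cos2Dsin2; rewrite /= => -> ; rewrite mul1r.
have sgauge : square_integrable leb2 sq gauge.
  rewrite /square_integrable (_ : (fun _ => _) = cst (nsq (pseq_char x1 k))%:E); last first.
    by apply/funext => z; congr EFin; exact: gauge1.
  apply/integrableP; split; first exact: measurable_cst.
  rewrite (eq_integral (cst (nsq (pseq_char x1 k))%:E)); last first.
    by move=> z _; rewrite gee0_abs// lee_fin nsq_ge0.
  have sq1 : leb2 sq = 1%E.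
    have l01 : leb `[0%R, 1%R] = 1%E.
      by rewrite lebesgue_measure_itv /= lte_fin ltr01 -EFinB subr0.
    rewrite [LHS]product_measure1E; do ?exact: measurable_itv.
    exact: (etrans (congr2 mule l01 l01) (mule1 _)).
  rewrite integral_cst//; last exact: msq.
  by rewrite (congr1 (mule _) sq1) mule1 ltry.
have gi : cintegrable leb2 sq (fun z => hip (gauge z) (w z)).
  by have [] := integrable_hip msq mgauge sgauge mw sw.
have g0 : {ae leb2, forall z, sq z -> hip (gauge z) (w z) = 0}.
  apply: fourier_uniqueness => // A m mA.
  pose n := k - q%:Z * m.
  pose r0 := [seq n - a * i%:Z | i <- iota 0 `|numq x1|.+1].
  pose r1 := undup (r0 ++ [seq j - 1 | j <- r0]).
  pose u : L2R R := L2Fun (test_fun_mem mA n).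
  pose v : L2sq := L2Fun (zak_mem x1 a u (undup_uniq _ : uniq r1)).
  have uv : zak_rel u v.
    by apply: (@zak_rel_supported _ _ _ r0) => // s; exact: test_fun_supported.
  have [mv sv] := L2_mem v; rewrite -(orth _ _ uv).
  apply: (cintegral_ae msq).
  - apply: cmeasurableM.
      split; last exact: measurable_cst.
      by apply: (measurableT_comp _ m1); exact: measurable_indic.
    apply: cmeasurableM; last exact: cmeasurable_hip.
    by apply: measurable_expi; do ?[apply: measurable_funM => //].
  - exact: cmeasurable_hip.
  - apply: negligibleS (square_null_fst 1) => -[t x] /= /not_implyP[[+ _]].
    rewrite /= in_itv /= => /andP[t0 t1] neq; apply: contrapT => /eqP tn; apply: neq.
    have t01 : 0 <= t < 1 by rewrite t0 lt_neqAle tn t1.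
    rewrite -[pseq_hip (gauge _) _]/(hip (gauge (t, x)) (w (t, x))).
    rewrite -[pseq_hip (zak _ _ _) _]/(hip (zak r1 (test_fun A n) (t, x)) (w (t, x))).
    rewrite zak_test_fun//.
    have -> : @pseq_char R x1 n = pseq_char x1 k.
      apply: pseq_eq => i; rewrite !pseq_charE /n mulrC -mulNr addrC modzMDl.
      by [].
    rewrite !hipZl -!mulrA; congr (_ * _); rewrite mulrA -expiD; congr (expi _ * _).
    have q0 : q%:R != 0 :> R by rewrite pnatr_eq0 -lt0n qden_gt0.
    by rewrite /n !(rmorphB, rmorphM) /= -!pmulrn; field.
apply: filterS g0 => z g0 sz; move: (g0 sz).
rewrite hipZl hipC hip_pseq_char => /eqP.
by rewrite mulf_eq0 (negbTE (expi_neq0 _)) conjc_eq0 => /eqP.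
Qed.
End ZakTotal.

Theorem theorem1p2 (R : realType) (p : int) (q : nat) (x1 : rat) (h : R)
    (q_ge1 : (1 <= q)%N) (coprime_pq : coprime `|p|%N q)
    (x1E : x1 = p%:~R / q%:R) (x1_01 : 0 <= x1 <= 1)
    (hE : h = ratr x1) (h_neq0 : h != 0) :
  unitarily_equivalent
    (restrict_rep (heis_inclM R) (schrodinger h))
    (direct_integral (@lebesgue_measure R \x @lebesgue_measure R)%E
       (@measurable_square01 R)
       (rho := fun x => rho_fin x1 (fracpart (q%:R * ratr x1 * x.1)) x.2)
       (@measurable_rho_fin_frac R x1 (q%:R * ratr x1))).
Proof.
have qE : q = qden x1.
  rewrite /qden x1E -[q%:R]/(q%:Z%:~R) coprimeq_den//.
  by case: q q_ge1 {coprime_pq x1E}.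
subst q; have /andP[x1_ge0 _] := x1_01.
have [[a b] /= ab] : exists ab : int * int,
    ab.1 * numq x1 + ab.2 * denq x1 = 1.
  by apply/coprimezP; exact: coprime_num_den.
have a_inv : (a * numq x1 = 1 %[mod (qden x1)%:Z])%Z.
  have -> : (qden x1)%:Z = denq x1 by rewrite gez0_abs// denq_ge0.
  by rewrite -ab addrC modzMDl.
apply: (unitary_extension (T := @zak_rel R x1 a)).
- exact: L2_complete.
- exact: L2_complete.
- by move=> c u w u' w'; exact: zak_rel_lin.
- by move=> u w; exact: zak_rel_nsq.
- by move=> u e e0; exact: zak_rel_dense.
- by move=> z; exact: zak_rel_total.
- by move=> n u w; exact: zak_rel_rep.
Qed.
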